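(* Let $n\ge2$ and $k\ge2$ be integers, let $\varepsilon\ge0$, and assume that there exists a non-connected domain $\Omega=A\cup B$ in $\mathbb{R}^n$ (with $A$ and $B$ disjoint domains) such that $|A|+|B|=1$ and $$\mu_k(A\cup B)^{n/2}\ge\mu^*_k(n)^{n/2}-\varepsilon.$$ Then there exists an integer $i\in\{1,\dots,k-1\}$ such that $$0\le\mu^*_k(n)^{n/2}-\left[\mu^*_i(n)^{n/2}+\mu^*_{k-i}(n)^{n/2}\right]\le\varepsilon,$$ $$0\le\mu^*_i(n)^{n/2}-\mu_i(A)^{n/2}|A|\le\varepsilon\quad\text{and}\quad 0\le\mu^*_{k-i}(n)^{n/2}-\mu_{k-i}(B)^{n/2}|B|\le\varepsilon.$$
   Context: ''Domain'' means a nonempty bounded open subset of $\mathbb{R}^n$ with sufficiently regular boundary (e.g. Lipschitz, so that the Neumann spectrum is discrete); domains are not required to be connected. $|\Omega|$ denotes the volume of $\Omega$. $0=\mu_0(\Omega)\le\mu_1(\Omega)\le\mu_2(\Omega)\le\cdots$ are the eigenvalues of the (positive) Laplacian on $\Omega$ with Neumann boundary conditions, repeated according to multiplicity and numbered from $0$. The spectrum of a disjoint union $A\cup B$ is the re-ordered union (with multiplicity) of the spectra of $A$ and $B$. Define $\mu^*_k(n)=\sup\{\mu_k(\Omega):\Omega\subset\mathbb{R}^n\text{ a domain},\ |\Omega|=1\}$ (known to be finite). *)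

(* Defs.v *)
From HB Require Import structures.
From mathcomp Require Import all_boot all_order all_algebra.
From mathcomp Require Import all_classical all_reals all_analysis.

Set Implicit Arguments.
Unset Strict Implicit.
Unset Printing Implicit Defensive.
Import Order.TTheory GRing.Theory Num.Theory.
Import numFieldNormedType.Exports.

Local Open Scope classical_set_scope.
Local Open Scope ring_scope.

Definition measure_rV_display : measure_display -> measure_display.
Proof. exact. Qed.

(* Row vectors get the product sigma-algebra of the Borel sets of R, in the
   same way as mathcomp-analysis does it for tuples. *)
Section measurable_rV.
Context {R : realType}.
Local Notation RR := (measurableTypeR R).
Variable n : nat.

Definition rV_coord (i : 'I_n) (x : 'rV[R]_n) : RR := x ord0 i.

Let rV_set0 : g_sigma_preimage rV_coord set0.
Proof. exact: sigma_algebra0. Qed.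

Let rV_setC A : g_sigma_preimage rV_coord A -> g_sigma_preimage rV_coord (~` A).
Proof. exact: sigma_algebraC. Qed.

Let rV_bigcup (F : (set 'rV[R]_n)^nat) :
  (forall i, g_sigma_preimage rV_coord (F i)) ->
  g_sigma_preimage rV_coord (\bigcup_i (F i)).
Proof. exact: sigma_algebra_bigcup. Qed.

HB.instance Definition _ :=
  @isMeasurable.Build (measure_rV_display default_measure_display)
  'rV[R]_n (g_sigma_preimage rV_coord) rV_set0 rV_setC rV_bigcup.

Let preim_bigcup :
  \big[setU/set0]_(i < n)
      preimage_set_system [set: 'rV[R]_n] (rV_coord i) measurable =
  \bigcup_(i in [set: 'I_n])
      preimage_set_system [set: 'rV[R]_n] (rV_coord i) measurable.
Proof.
by rewrite -bigcup_seq; apply: eq_bigcupl; split=> // i _ /=;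
  rewrite mem_index_enum.
Qed.

Lemma measurable_rV_coord (i : 'I_n) : measurable_fun setT (rV_coord i).
Proof.
move=> _ B mB; apply: sub_sigma_algebra.
by rewrite preim_bigcup; exists i => //; exists B.
Qed.

Definition rV_of_tuple (t : n.-tuple RR) : 'rV[R]_n := \row_i tnth t i.

Definition tuple_of_rV (x : 'rV[R]_n) : n.-tuple RR := [tuple rV_coord i x | i < n].

Lemma rV_of_tupleK : cancel rV_of_tuple tuple_of_rV.
Proof.
by move=> t; apply: eq_from_tnth => i; rewrite tnth_mktuple /rV_coord mxE.
Qed.

Lemma measurable_rV_of_tuple : measurable_fun setT rV_of_tuple.
Proof.
suff h : g_sigma_preimage rV_coord `<=`
    [set A | measurable (rV_of_tuple @^-1` A)].
  by move=> _ A /h mA; rewrite setTI.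
apply: smallest_sub.
  split => /=.
  - by rewrite preimage_set0.
  - by move=> A mA; rewrite setTD preimage_setC; exact: measurableC.
  - by move=> F mF; rewrite preimage_bigcup; exact: bigcup_measurable.
rewrite preim_bigcup => _ [i _ [B mB <-]] /=; rewrite setTI -comp_preimage.
rewrite (_ : rV_coord i \o rV_of_tuple = @tnth _ RR ^~ i); last first.
  by apply/funext => t; rewrite /= /rV_coord mxE.
by rewrite -[X in measurable X]setTI; exact: measurable_tnth.
Qed.

Lemma measurable_tuple_of_rV : measurable_fun setT tuple_of_rV.
Proof.
apply/measurable_fun_tnthP => i.
rewrite (_ : _ \o _ = rV_coord i); first exact: measurable_rV_coord.
by apply/funext => x; rewrite /= tnth_mktuple.
Qed.

End measurable_rV.

Section pushforward_bij.
Local Open Scope ereal_scope.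
Context {d1 d2} {T1 : measurableType d1} {T2 : measurableType d2}.
Context {R : realType} (m : {sigma_finite_measure set T1 -> \bar R}).
Variables (f : T1 -> T2) (g : T2 -> T1).
Hypotheses (mf : measurable_fun setT f) (mg : measurable_fun setT g).
Hypothesis fK : cancel f g.

Definition pushforward_bij : set T2 -> \bar R := pushforward m f.

Let p0 : pushforward_bij set0 = 0.
Proof. by rewrite /pushforward_bij /pushforward preimage_set0 measure0. Qed.

Let p_ge0 A : 0 <= pushforward_bij A.
Proof. exact: measure_ge0. Qed.

Let p_sigma_additive : semi_sigma_additive pushforward_bij.
Proof.
exact: (@measure_semi_sigma_additive _ _ _
  (measure_function_pushforward__canonical__measure_function_Measure m mf)).
Qed.

HB.instance Definition _ := isMeasure.Build _ _ _ pushforward_bij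
  p0 p_ge0 p_sigma_additive.

Let p_sigma_finite : sigma_finite setT pushforward_bij.
Proof.
have [F TF mF] := sigma_finiteT m.
exists (fun i => g @^-1` F i).
  by rewrite -preimage_bigcup -TF preimage_setT.
move=> i; have [mFi Foo] := mF i; split.
  by rewrite -[X in measurable X]setTI; exact: mg.
rewrite /pushforward_bij /pushforward -comp_preimage.
by rewrite (_ : g \o f = id) ?preimage_id//; apply/funext => x /=.
Qed.

HB.instance Definition _ := Measure_isSigmaFinite.Build _ _ _ pushforward_bij
  p_sigma_finite.

Definition sigma_finite_pushforward :
  {sigma_finite_measure set T2 -> \bar R} := pushforward_bij.

End pushforward_bij.

(* The library's canonical sigma-finite structure on [m1 \x m2] is restricted
   to subprobabilities. *)
Section sigma_finite_product.
Local Open Scope ereal_scope.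
Context {d1 d2} {T1 : measurableType d1} {T2 : measurableType d2} {R : realType}.
Variable m1 : {sigma_finite_measure set T1 -> \bar R}.
Variable m2 : {sigma_finite_measure set T2 -> \bar R}.

Definition product_sf : set (T1 * T2)%type -> \bar R := m1 \x m2.

HB.instance Definition _ := Measure.on product_sf.

Let product_sigma_finite : sigma_finite setT product_sf.
Proof.
have /sigma_finiteP[F [TF ndF Foo]] := sigma_finiteT m1.
have /sigma_finiteP[G [TG ndG Goo]] := sigma_finiteT m2.
exists (fun n => F n `*` G n).
  rewrite -setXTT TF TG predeqE => -[x y]; split.
    move=> [/= [n _ Fnx] [k _ Gky]]; exists (maxn n k) => //; split.
    - by move: x Fnx; exact/subsetPset/ndF/leq_maxl.
    - by move: y Gky; exact/subsetPset/ndG/leq_maxr.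
  by move=> [n _ []/= ? ?]; split; exists n.
move=> k; have [? ?] := Foo k; have [? ?] := Goo k.
split; first exact: measurableX.
by rewrite /product_sf product_measure1E// lte_mul_pinfty// ge0_fin_numE.
Qed.

HB.instance Definition _ := Measure_isSigmaFinite.Build _ _ _ product_sf
  product_sigma_finite.

Definition sigma_finite_product :
  {sigma_finite_measure set (T1 * T2)%type -> \bar R} := product_sf.

End sigma_finite_product.

Section lebesgue_measure_rV.
Context {R : realType}.
Local Notation RR := (measurableTypeR R).

Definition cons_pair (n : nat) (p : RR * n.-tuple RR) : n.+1.-tuple RR :=
  [tuple of p.1 :: p.2].

Definition uncons (n : nat) (t : n.+1.-tuple RR) : RR * n.-tuple RR :=
  (tnth t ord0, [tuple of behead t]).

Lemma cons_pairK n : cancel (@cons_pair n) (@uncons n).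
Proof.
by move=> [x t]; congr pair; rewrite ?tnth0//; exact/val_inj.
Qed.

Lemma measurable_cons_pair n : measurable_fun setT (@cons_pair n).
Proof. exact: measurable_cons. Qed.

Lemma measurable_uncons n : measurable_fun setT (@uncons n).
Proof.
apply: measurable_fun_pair; [exact: measurable_tnth|exact: measurable_behead].
Qed.

Fixpoint lebesgue_tuple (n : nat) :
    {sigma_finite_measure set (n.-tuple RR) -> \bar R} :=
  match n with
  | 0 => \d_ [tuple]
  | n'.+1 => sigma_finite_pushforward
      (sigma_finite_product (@lebesgue_measure R) (lebesgue_tuple n'))
      (@measurable_cons_pair n') (@measurable_uncons n') (@cons_pairK n')
  end.

Definition lebesgue_rV (n : nat) :
    {sigma_finite_measure set 'rV[R]_n -> \bar R} :=
  sigma_finite_pushforward (lebesgue_tuple n)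
    (@measurable_rV_of_tuple R n) (@measurable_tuple_of_rV R n)
    (@rV_of_tupleK R n).

End lebesgue_measure_rV.

Section neumann_spectrum.
Context {R : realType} {n : nat}.
Local Notation V := 'rV[R]_n.
Local Notation leb := (@lebesgue_rV R n).
Implicit Types (Omega : set V) (u v f phi : V -> R).

Definition dotrV (x y : V) : R := (x *m y^T) ord0 ord0.

Definition partial (i : 'I_n) f : V -> R := fun x => 'D_(delta_mx ord0 i) f x.

Definition smooth f :=
  forall s : seq 'I_n,
    continuous (foldr partial f s) /\
    forall (i : 'I_n) x, derivable (foldr partial f s) x (delta_mx ord0 i).

Definition test_function Omega phi :=
  smooth phi /\
  exists K : set V, [/\ compact K, K `<=` Omega & forall x, ~ K x -> phi x = 0].

Definition L2 Omega u :=
  measurable_fun Omega (u : V -> measurableTypeR R) /\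
  leb.-integrable Omega (fun x => (u x ^+ 2)%:E).

Definition L2dot Omega u v : R := \int[leb]_(x in Omega) (u x * v x).

Definition weak_partial Omega (i : 'I_n) u (g : V -> R) :=
  forall phi, test_function Omega phi ->
    L2dot Omega u (partial i phi) = - L2dot Omega g phi.

(* u is in the Sobolev space H^1(Omega), with weak gradient g. *)
Definition H1_grad Omega u (g : 'I_n -> V -> R) :=
  L2 Omega u /\ forall i, L2 Omega (g i) /\ weak_partial Omega i u (g i).

(* Weak form of - Laplacian u = lambda u in Omega with du/dnu = 0 on the
   boundary: the boundary condition is the natural one, encoded by testing
   against all of H^1(Omega). *)
Definition neumann_eigenfunction Omega (lambda : R) u :=
  ~ (\forall x \ae leb, Omega x -> u x = 0) /\
  exists2 g, H1_grad Omega u g &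
    forall v h, H1_grad Omega v h ->
      \sum_(i < n) L2dot Omega (g i) (h i) = lambda * L2dot Omega u v.

Definition lin_indep_ae Omega (N : nat) (u : 'I_N -> V -> R) :=
  forall c : 'I_N -> R,
    (\forall x \ae leb, Omega x -> \sum_(j < N) c j * u j x = 0) ->
    forall j, c j = 0.

(* At least N eigenvalues, counted with multiplicity, are <= lambda.  (Distinct
   eigenvalues have orthogonal eigenspaces, so a maximal independent family
   consists of one basis for each eigenspace.) *)
Definition neumann_count_ge Omega (N : nat) (lambda : R) :=
  exists (u : 'I_N -> V -> R) (mu : 'I_N -> R),
    (forall j, neumann_eigenfunction Omega (mu j) (u j) /\ mu j <= lambda) /\
    lin_indep_ae Omega u.

(* mu_k(Omega): the entry number k, from 0, in the increasing list of the
   eigenvalues repeated according to multiplicity. *)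
Definition neumann_eigenvalue Omega (k : nat) : R :=
  inf [set lambda | neumann_count_ge Omega k.+1 lambda].

(* The eigenfunctions contain a Hilbert basis of L^2(Omega), and the eigenvalues
   have finite multiplicity and no finite accumulation point. *)
Definition discrete_neumann_spectrum Omega :=
  exists (u : nat -> V -> R) (lambda : nat -> R),
    [/\ forall j, neumann_eigenfunction Omega (lambda j) (u j),
        forall i j, L2dot Omega (u i) (u j) = (i == j)%:R,
        forall f, L2 Omega f -> (forall j, L2dot Omega f (u j) = 0) ->
          \forall x \ae leb, Omega x -> f x = 0
      & lambda j @[j --> \oo] --> +oo].

(* Near each boundary point, Omega is the set of points lying strictly above the
   graph of a Lipschitz function over the hyperplane orthogonal to a unit vector
   e; y - <y, e> e is the orthogonal projection of y on that hyperplane. *)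
Definition lipschitz_boundary Omega :=
  forall x, (closure Omega `\` Omega°) x ->
    exists (e : V) (gamma : V -> R) (r : R),
      [/\ dotrV e e = 1, lipschitz gamma, 0 < r
        & forall y, ball x r y ->
            (Omega y <-> gamma (y - dotrV y e *: e) < dotrV y e)].

(* For bounded open sets with Lipschitz boundary the last condition is automatic
   (Rellich's theorem). *)
Definition is_domain Omega :=
  [/\ Omega !=set0, bounded_set Omega, open Omega, lipschitz_boundary Omega
    & discrete_neumann_spectrum Omega].

Definition volume Omega : \bar R := leb Omega.

End neumann_spectrum.

Definition neumann_eigenvalue_sup (R : realType) (n k : nat) : \bar R :=
  ereal_sup [set (neumann_eigenvalue Omega k)%:E |
    Omega in [set Omega : set 'rV[R]_n | is_domain Omega /\ volume Omega = 1%E]].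

(* Main.v *)
Require Import Defs.
From mathcomp Require Import all_boot all_order all_algebra.
From mathcomp Require Import all_classical all_reals all_analysis.
From mathcomp Require Import measurable_realfun.
From mathcomp Require Import ring lra.
Import Order.TTheory GRing.Theory Num.Theory numFieldNormedType.Exports.

(** Write [p = n/2], let [mu] be the eigenvalue of index [k] of [A `|` B], and let
[s], [a'], [b'] be the powers [p] of the suprema of index [k], [i], [k - i].

Counting. The spectrum of a disjoint union is the union of the spectra. If
[mu > 0], let [i] be the number of eigenvalues of [A] below [mu]; then the
eigenvalue of index [i] of [A] and the one of index [k - i] of [B] are at least
[mu], and [0 < i < k] because [0] is an eigenvalue of both pieces
([neumann_eigenvalueU_split]). If [mu = 0], any index will do.
As the volumes add up to [1], it follows that
[mu ^ p <= a + b], where [a = mu_i(A) ^ p |A|] and [b = mu_(k-i)(B) ^ p |B|].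
These products are invariant under dilation, so [a <= a'] and [b <= b']
([unit_rescaling]).

Superadditivity. Two domains of volume [1] can be dilated so that their
eigenvalues of index [i] and [k - i] agree and the volumes add up to [1]; placed
apart they form a competitor for the index [k] ([unit_domain_union]). Hence
[a' + b' <= s].

Together with the hypothesis, [s - eps <= mu ^ p <= a + b <= a' + b' <= s], and
each of the three defects is bounded by the total slack [eps]
([sandwich_defects]).

The spectral facts rest on eigenbases. The counting function, defined by linearly
independent eigenfunctions, can be read off any eigenbasis ([neumann_count_geP]);
eigenbases of two disjoint open sets, extended by zero, interleave to one of the
union ([eigenbasisU]); and affine changes of variables transport them
([eigenbasis_aff]). The analytic inputs are the scaling rule of Lebesgue measure
([lebesgue_rV_aff]), the fact that zero extension respects weak derivatives on a
disjoint union ([test_function_restrict]), and the vanishing of the integral of a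
partial derivative of a test function ([Rintegral_partial0]), which makes the
constants eigenfunctions. *)

Set Implicit Arguments.
Unset Strict Implicit.
Unset Printing Implicit Defensive.

Local Open Scope classical_set_scope.
Local Open Scope ring_scope.

(** * Lebesgue measure under affine maps *)

Section affine_lebesgue.
Context {R : realType}.
Local Notation RR := (measurableTypeR R).

Let affR (a b : R) (x : RR) : RR := a * x + b.

Let measurable_affR (a b : R) : measurable_fun setT (affR a b).
Proof. by apply: measurable_funD => //; exact: measurable_funM. Qed.

Lemma lebesgue_measure_aff (a b : R) (A : set RR) : 0 < a -> measurable A ->
  lebesgue_measure ((fun x : RR => a * x + b : RR) @^-1` A) =
  (a^-1%:E * lebesgue_measure A)%E.
Proof.
move=> a0 mA; have a0' := ltW a0.
pose m' := mscale (NngNum a0')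
  (measure_function_pushforward__canonical__measure_function_Measure
    (@lebesgue_measure R) (measurable_affR a b)).
have m'E B : m' B = (a%:E * lebesgue_measure (affR a b @^-1` B))%E by [].
have -> : lebesgue_measure A = m' A.
  apply: lebesgue_measure_unique => // _ [[c d]] _ <-.
  transitivity (a%:E * lebesgue_measure (affR a b @^-1` `]c, d]))%E => //.
  rewrite (_ : _ @^-1` _ = `](c - b) / a, (d - b) / a]%classic); last first.
    by apply/seteqP; split=> x /=; rewrite !in_itv/= ltr_pdivrMr// ler_pdivlMr//
      ltrBlDr lerBrDr (mulrC x).
  rewrite !lebesgue_measure_itv/= !lte_fin ltr_pM2r ?invr_gt0// ltrD2r.
  case: ifP => _; rewrite ?mule0// -!EFinD -EFinM; congr EFin.
  by field; rewrite gt_eqF.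
by rewrite m'E muleA -EFinM mulVf ?gt_eqF// mul1e.
Qed.

Definition aff_tuple n (a : R) (b : nat -> R) (t : n.-tuple RR) : n.-tuple RR :=
  [tuple affR a (b i) (tnth t i) | i < n].

Lemma measurable_aff_tuple n a b : measurable_fun setT (@aff_tuple n a b).
Proof.
apply/measurable_fun_tnthP => i.
rewrite (_ : _ \o _ = affR a (b i) \o (@tnth n RR ^~ i)); last first.
  by apply/funext => t /=; rewrite tnth_mktuple.
by apply: measurableT_comp; [exact: measurable_affR|exact: measurable_tnth].
Qed.

(** The measure on tuples is built one coordinate at a time, so slicing along the
first coordinate reduces a coordinatewise affine map to the one-dimensional
scaling rule, each coordinate contributing a factor [a^-1]. *)
Lemma lebesgue_tuple_aff n a b (S : set (n.-tuple RR)) : 0 < a -> measurable S ->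
  lebesgue_tuple n (@aff_tuple n a b @^-1` S) =
  ((a ^- n)%:E * lebesgue_tuple n S)%E.
Proof.
move=> a0; elim: n b S => [|n IH] b S mS.
  rewrite expr0 invr1 mul1e (_ : _ @^-1` S = S)//.
  by apply/funext => t /=; rewrite /preimage/= [aff_tuple _ _ _]tuple0 [t]tuple0.
have E T : lebesgue_tuple n.+1 T = (\int[lebesgue_measure]_x
    lebesgue_tuple n (xsection (@cons_pair R n @^-1` T) x))%E by [].
rewrite !E.
have mS' : measurable (@cons_pair R n @^-1` S).
  by rewrite -[X in measurable X]setTI; exact: measurable_cons_pair.
set g := fun x : RR => lebesgue_tuple n (xsection (@cons_pair R n @^-1` S) x).
have mg : measurable_fun setT g.
  exact: (measurable_fun_xsection (lebesgue_tuple n)).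
have g0 x : (0 <= g x)%E by exact: measure_ge0.
transitivity (\int[lebesgue_measure]_x
   ((a ^- n)%:E * (g \o affR a (b 0%N)) x))%E.
  apply: eq_integral => x _; rewrite /= /g -(IH (fun i => b i.+1)); last first.
    exact: measurable_xsection.
  congr (lebesgue_tuple n _).
  have H t : @aff_tuple n.+1 a b (cons_pair (x, t)) =
      cons_pair (affR a (b 0%N) x, @aff_tuple n a (fun i => b i.+1) t).
    apply: eq_from_tnth => i; rewrite tnth_mktuple.
    case: (unliftP ord0 i) => [j|] ->.
      by rewrite !tnthS/= tnth_mktuple; congr affR; congr tnth; exact: val_inj.
    by rewrite !tnth0.
  by apply/seteqP; split => t; rewrite /= /xsection/= !inE/= H.
rewrite ge0_integralZl//; last 2 first.
  exact: measurableT_comp.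
  by rewrite lee_fin invr_ge0 exprn_ge0// ltW.
(* The remaining factor [a^-1] comes from the change of variables in the first
   coordinate. *)
rewrite exprSr invfM EFinM -muleA; congr (_ * _)%E.
have := @ge0_integral_pushforward _ _ _ _ R _ (measurable_affR a (b 0%N))
  (@lebesgue_measure R) setT g measurableT mg (fun x _ => g0 x).
rewrite preimage_setT => <-.
have a0' : 0 <= a^-1 by rewrite invr_ge0 ltW.
have := @ge0_integral_mscale _ _ R (@lebesgue_measure R) setT measurableT
  (NngNum a0') g mg (fun x _ => g0 x).
move=> <-.
apply: eq_measure_integral => A mA _; exact: lebesgue_measure_aff.
Qed.

End affine_lebesgue.

Lemma lebesgue_tuple_box {R : realType} (r : R) n :
  (lebesgue_tuple n [set t | forall i, (- r <= tnth t i <= r)%R] < +oo)%E.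
Proof.
elim: n => [|n IH]; first by rewrite /= diracE ltry.
rewrite /= /pushforward_bij /pushforward /product_sf.
rewrite (_ : _ @^-1` _ =
    `[- r, r]%classic `*` [set t | forall i, - r <= tnth t i <= r]).
  rewrite product_measure1E//=.
    by rewrite lte_mul_pinfty// lebesgue_measure_itv//=; case: ifP.
  rewrite (_ : [set _ | _] = \bigcap_i ((@tnth _ _ ^~ i) @^-1` `[- r, r]%classic)).
    apply: fin_bigcap_measurable => // i _.
    by rewrite -[X in measurable X]setTI; exact: measurable_tnth.
  by apply/seteqP; split => t /= h; [move=> i _; exact: h|move=> i; exact: h].
apply/seteqP; split => -[x t] /=.
  move=> h; split; first by have := h ord0; rewrite tnth0.
  by move=> i; have := h (lift ord0 i); rewrite tnthS.
move=> [xr h] i; case: (unliftP ord0 i) => [j|] ->; rewrite ?tnth0// tnthS.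
have tE : [tuple of behead (cons_pair (x, t))] = t by exact: val_inj.
by have := h j; rewrite -{1 2}tE.
Qed.

Section lebesgue_rV_theory.
Context {R : realType} {n : nat}.
Local Notation V := 'rV[R]_n.
Local Notation RR := (measurableTypeR R).
Local Notation leb := (@lebesgue_rV R n).
Implicit Types (a : R) (b x : V) (D S : set V).

(** The sigma-algebra is generated by the coordinates, so each cube is measurable;
an open set is the union of the countably many cubes with rational centre and
radius [1/(m+1)] that it contains. *)
Lemma open_measurable_rV S : open S -> measurable S.
Proof.
move=> oS.
pose box (p : 'rV[rat]_n * nat) : set V :=
  \bigcap_i (rV_coord i @^-1` (ball (ratr (p.1 ord0 i) : R) p.2.+1%:R^-1)).
have mbox p : measurable (box p).
  apply: fin_bigcap_measurable => // i _.
  rewrite -[X in measurable X]setTI; apply: measurable_rV_coord => //.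
  exact: measurable_ball.
pose F p := if `[< box p `<=` S >] then box p else set0.
have mF p : measurable (F p) by rewrite /F; case: ifP.
suff -> : S = \bigcup_p F p.
  by apply: countable_bigcupT_measurable => //; exact: countableP.
apply/seteqP; split => [x Sx|x [p _]]; last first.
  by rewrite /F; case: ifPn => // /asboolP; exact.
have /nbhs_ballP[e /= e0 xeS] := open_nbhs_nbhs (conj oS Sx).
pose m := Num.trunc (2 / e).
have me : m.+1%:R^-1 + m.+1%:R^-1 < e.
  have : 2 / e < m.+1%:R by exact: truncnS_gt.
  rewrite ltr_pdivrMr// mulrC => h.
  by rewrite -[_ + _]mulr2n -[_ *+ 2]mulr_natl ltr_pdivrMr.
have m0 : 0 < m.+1%:R^-1 :> R by rewrite invr_gt0.
have /choice[q qP] (i : 'I_n) : exists q : rat, ball (ratr q : R) m.+1%:R^-1 (x ord0 i).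
  have h : x ord0 i - m.+1%:R^-1 < x ord0 i + m.+1%:R^-1.
    by rewrite ltrD2l (lt_trans _ m0)// oppr_lt0.
  have [q] := rat_in_itvoo h.
  by rewrite in_itv/= -ltr_distlC => qP; exists q; rewrite /ball/= distrC.
exists (\row_i q i, m) => //; rewrite /F ifT.
  by move=> i _; rewrite /preimage/= mxE; exact: qP.
apply/asboolP => y boxy; apply: xeS.
split => // i j; rewrite (ord1 i); apply: le_ball (ltW me) _ _.
apply: ball_triangle (ball_sym (qP j)) _.
by have := boxy j Logic.I; rewrite /preimage/= mxE.
Qed.

Lemma continuous_measurable_rV (f : V -> RR) : continuous (f : V -> R) ->
  measurable_fun setT f.
Proof.
move=> cf; apply: (measurability _ (RGenOpens.measurableE R)).
move=> _ [_ [c [d ->] <-]]; rewrite setTI; apply: open_measurable_rV.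
by move/continuousP : cf; apply; exact: interval_open.
Qed.

(** Similarities without rotation. Domains are moved by taking preimages under
[aff a b], which dilates them by [a^-1]. *)
Definition aff a b x : V := a *: x + b.

Lemma affK a b : 0 < a -> cancel (aff a b) (aff a^-1 (- (a^-1 *: b))).
Proof.
by move=> a0 x; rewrite /aff scalerDr scalerA mulVf ?gt_eqF// scale1r addrK.
Qed.

Lemma affVK a b : 0 < a -> cancel (aff a^-1 (- (a^-1 *: b))) (aff a b).
Proof.
move=> a0 x; rewrite /aff scalerDr scalerN !scalerA mulfV ?gt_eqF//.
by rewrite !scale1r addrNK.
Qed.

Lemma measurable_aff a b : measurable_fun setT (aff a b).
Proof.
rewrite (_ : aff a b =
    @rV_of_tuple R n \o aff_tuple a (fun k => oapp (b ord0) 0 (insub k)) \o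
      @tuple_of_rV R n).
  apply: measurableT_comp; last exact: measurable_tuple_of_rV.
  apply: measurableT_comp; first exact: measurable_rV_of_tuple.
  exact: measurable_aff_tuple.
apply/funext => x; apply/rowP => i; by rewrite !mxE !tnth_mktuple valK.
Qed.

Lemma measurable_aff_preimage a b S :
  measurable S -> measurable (aff a b @^-1` S).
Proof.
by move=> mS; rewrite -[X in measurable X]setTI; exact: measurable_aff.
Qed.

Lemma lebesgue_rV_aff a b S : 0 < a -> measurable S ->
  leb (aff a b @^-1` S) = ((a ^- n)%:E * leb S)%E.
Proof.
move=> a0 mS.
have E T : leb T = lebesgue_tuple n (@rV_of_tuple R n @^-1` T) by [].
rewrite !E -(lebesgue_tuple_aff (fun k => oapp (b ord0) 0 (insub k)))//; last first.
  by rewrite -[X in measurable X]setTI; exact: measurable_rV_of_tuple.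
congr (lebesgue_tuple n _).
apply/funext => t; congr (S _).
by apply/rowP => i; rewrite !mxE tnth_mktuple valK.
Qed.

Lemma ge0_integral_aff a b D (f : V -> \bar R) : 0 < a -> measurable D ->
    measurable_fun D f -> (forall x, D x -> 0 <= f x)%E ->
  (\int[leb]_(x in aff a b @^-1` D) f (aff a b x) =
   (a ^- n)%:E * \int[leb]_(x in D) f x)%E.
Proof.
move=> a0 mD mf f0.
have c0 : 0 <= a ^- n by rewrite invr_ge0 exprn_ge0// ltW.
rewrite -[RHS](ge0_integral_mscale leb mD (NngNum c0))//.
rewrite -[LHS](ge0_integral_pushforward (measurable_aff a b))//; last first.
  by move=> y; rewrite inE; exact: f0.
apply: eq_measure_integral => [|m S mS _].
  exact: measurable_aff.
exact: (lebesgue_rV_aff b a0 mS).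
Qed.

Lemma Rintegral_aff a b D (f : V -> R) : 0 < a -> measurable D ->
    measurable_fun D (f : V -> RR) ->
  \int[leb]_(x in aff a b @^-1` D) f (aff a b x) =
  a ^- n * \int[leb]_(x in D) f x.
Proof.
move=> a0 mD mf; have an0 : 0 < a ^- n by rewrite invr_gt0 exprn_gt0.
have mf' : measurable_fun D (EFin \o f) by exact/measurable_EFinP.
(* The positive and negative parts are treated separately; the case
   analysis at the end covers infinite integrals. *)
rewrite /Rintegral integralE [in RHS]integralE.
rewrite (_ : (EFin \o (f \o aff a b))^\+%E = (EFin \o f)^\+%E \o aff a b); last first.
  exact: (funepos_comp (EFin \o f) (aff a b)).
rewrite (_ : (EFin \o (f \o aff a b))^\-%E = (EFin \o f)^\-%E \o aff a b); last first.
  exact: (funeneg_comp (EFin \o f) (aff a b)).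
have mfp := measurable_funepos mf'; have mfn := measurable_funeneg mf'.
rewrite (ge0_integral_aff b a0 mD mfp)// (ge0_integral_aff b a0 mD mfn)//.
have : (0 <= \int[leb]_(x in D) (EFin \o f)^\+%E x)%E by exact: integral_ge0.
have : (0 <= \int[leb]_(x in D) (EFin \o f)^\-%E x)%E by exact: integral_ge0.
case: (integral _ _ _) => [q||]//; case: (integral _ _ _) => [p||]// _ _.
- by rewrite -!EFinM -!EFinB/= mulrBr.
- by rewrite -!EFinM gt0_muley ?lte_fin//= mulr0.
- by rewrite -!EFinM gt0_muley ?lte_fin//= mulr0.
- by rewrite gt0_muley ?lte_fin//= mulr0.
Qed.

Lemma norm_coord_le x (i : 'I_n) : `|x ord0 i| <= `|x|.
Proof. by rewrite [leRHS]mx_normrE (le_bigmax _ _ (ord0, i)). Qed.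

Lemma bounded_lebesgue_rV S : measurable S -> bounded_set S -> (leb S < +oo)%E.
Proof.
move=> mS [M [Mr HM]].
have {}HM : forall x, S x -> `|x| <= M + 1 by apply: HM; rewrite ltrDl.
pose B : set V := [set x | forall i,
  - (M + 1) <= tnth (tuple_of_rV x) i <= M + 1].
have mB : measurable B.
  rewrite (_ : B = \bigcap_i (rV_coord i @^-1` `[- (M + 1), M + 1]%classic)).
    apply: fin_bigcap_measurable => // i _.
    by rewrite -[X in measurable X]setTI; exact: measurable_rV_coord.
  apply/seteqP; split => x /= h.
    by move=> i _; have := h i; rewrite tnth_mktuple.
  by move=> i; rewrite tnth_mktuple; exact: h i Logic.I.
apply: (@le_lt_trans _ _ (leb B)).
  apply: le_measure; rewrite ?inE//.
  move=> x /HM xM i; rewrite tnth_mktuple -ler_norml.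
  exact: le_trans (norm_coord_le _ _) xM.
have := @lebesgue_tuple_box R (M + 1) n; congr (_ < _)%E.
rewrite /= /pushforward_bij/= /pushforward/=; congr (lebesgue_tuple n _).
by apply/funext => t; rewrite /preimage /B /mkset rV_of_tupleK.
Qed.

End lebesgue_rV_theory.

(** * Square integrable functions *)

Section L2_theory.
Context {R : realType} {n : nat}.
Local Notation V := 'rV[R]_n.
Local Notation RR := (measurableTypeR R).
Local Notation leb := (@lebesgue_rV R n).
Variable Omega : set V.
Hypothesis mO : measurable Omega.
Implicit Types (u v w : V -> R) (a : R).

(** Young's inequality [2 |u v| <= u^2 + v^2]. *)
Lemma L2_integrableM u v : L2 Omega u -> L2 Omega v ->
  leb.-integrable Omega (fun x => (u x * v x)%:E).
Proof.
move=> [mu iu] [mv iv]; apply: (le_integrable mO _ _ (integrableD mO iu iv)).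
  by apply/measurable_EFinP; exact: measurable_funM.
move=> x _; rewrite /= lee_fin normrM [leRHS]ger0_norm ?addr_ge0 ?sqr_ge0//.
rewrite -(real_normK (num_real (u x))) -(real_normK (num_real (v x))).
have := sqr_ge0 (`|u x| - `|v x|); have := normr_ge0 (u x); have := normr_ge0 (v x).
by set p := `|u x|; set q := `|v x|; nra.
Qed.

Lemma L2Z a u : L2 Omega u -> L2 Omega (fun x => a * u x).
Proof.
move=> [mu iu]; split; first exact: measurable_funM.
apply: (eq_integrable mO _ _ _ (integrableZl mO (a ^+ 2) iu)) => x _.
by rewrite /= -EFinM exprMn.
Qed.

Lemma L2D u v : L2 Omega u -> L2 Omega v -> L2 Omega (fun x => u x + v x).
Proof.
move=> L2u L2v; split; first by apply: measurable_funD; [case: L2u|case: L2v].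
have [iu iv iuv] := And3 (proj2 L2u) (proj2 L2v) (L2_integrableM L2u L2v).
apply: (eq_integrable mO _ _ _ (integrableD mO (integrableD mO iu iv)
  (integrableD mO iuv iuv))) => x _.
by rewrite /= -!EFinD; congr EFin; ring.
Qed.

Lemma L2_cst0 : L2 Omega (cst 0).
Proof.
split; first exact: measurable_cst.
by apply: (eq_integrable mO _ _ _ (integrable0 leb Omega)) => x _ /=; rewrite expr0n.
Qed.

Lemma L2_sum N (c : 'I_N -> R) (u : 'I_N -> V -> R) :
  (forall j, L2 Omega (u j)) -> L2 Omega (fun x => \sum_(j < N) c j * u j x).
Proof.
move=> L2u; elim: N c u L2u => [|N IH] c u L2u.
  under eq_fun do rewrite big_ord0.
  exact: L2_cst0.
under eq_fun do rewrite big_ord_recr.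
by apply: L2D; [exact: IH|exact: L2Z].
Qed.

Lemma L2dotC u v : L2dot Omega u v = L2dot Omega v u.
Proof. by apply: eq_Rintegral => x _; rewrite mulrC. Qed.

Lemma L2dotZl a u v : L2 Omega u -> L2 Omega v ->
  L2dot Omega (fun x => a * u x) v = a * L2dot Omega u v.
Proof.
move=> L2u L2v; rewrite /L2dot -RintegralZl//; last exact: L2_integrableM.
by apply: eq_Rintegral => x _; rewrite mulrA.
Qed.

Lemma L2dotDl u v w : L2 Omega u -> L2 Omega v -> L2 Omega w ->
  L2dot Omega (fun x => u x + v x) w = L2dot Omega u w + L2dot Omega v w.
Proof.
move=> L2u L2v L2w; rewrite /L2dot -RintegralD//; try exact: L2_integrableM.
by apply: eq_Rintegral => x _; rewrite mulrDl.
Qed.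

Lemma L2dot_suml N (c : 'I_N -> R) (u : 'I_N -> V -> R) v :
  (forall j, L2 Omega (u j)) -> L2 Omega v ->
  L2dot Omega (fun x => \sum_(j < N) c j * u j x) v =
  \sum_(j < N) c j * L2dot Omega (u j) v.
Proof.
move=> + L2v; elim: N c u => [|N IH] c u L2u.
  rewrite big_ord0; transitivity (0 * L2dot Omega v v); last by rewrite mul0r.
  rewrite -L2dotZl//; apply: eq_Rintegral => x _.
  by rewrite big_ord0 !mul0r.
rewrite big_ord_recr/= -IH// -L2dotZl// -L2dotDl//; last 2 first.
  exact: L2_sum.
  exact: L2Z.
by apply: eq_Rintegral => x _; rewrite big_ord_recr.
Qed.

Lemma L2dot_ae0 u v : L2 Omega u -> L2 Omega v ->
  (\forall x \ae leb, Omega x -> u x = 0) -> L2dot Omega u v = 0.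
Proof.
move=> [mu iu] [mv iv] u0; rewrite /L2dot /Rintegral.
rewrite (@ae_eq_integral _ _ _ leb Omega (cst 0%E)) ?integral0//.
  by apply/measurable_EFinP; exact: measurable_funM.
by apply: filterS u0 => x u0 /u0 -> ; rewrite mul0r.
Qed.

Lemma L2dot_self_gt0 u : L2 Omega u ->
  ~ (\forall x \ae leb, Omega x -> u x = 0) -> 0 < L2dot Omega u u.
Proof.
move=> L2u u0; have := Rintegral_ge0 leb (fun x (_ : Omega x) => sqr_ge0 (u x)).
under eq_Rintegral do rewrite expr2.
rewrite le_eqVlt => /predU1P[/esym e|//]; case: u0.
have [mu iu] := L2u; have iuu := L2_integrableM L2u L2u.
have : (\int[leb]_(x in Omega) `|(u x * u x)%:E| = 0)%E.
  rewrite -[RHS]/(0%:E) -[in RHS]e fineK ?(integrable_fin_num mO iuu)//.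
  by apply: eq_integral => x _; rewrite /= ger0_norm// -expr2 sqr_ge0.
move=> /(ae_eq_integral_abs leb mO (measurable_int _ iuu)).
apply: filterS => x h /h [] /eqP.
by rewrite -expr2 sqrf_eq0 => /eqP.
Qed.

Lemma L2_cst a : (leb Omega < +oo)%E -> L2 Omega (cst a).
Proof.
move=> fO; split; first exact: measurable_cst.
have bd : [bounded (cst (a ^+ 2) : V -> R) x | x in Omega].
  exists (a ^+ 2); split; first exact: num_real.
  by move=> M aM x _ /=; rewrite ger0_norm ?sqr_ge0// ltW.
exact: (measurable_bounded_integrable mO fO (measurable_cst _) bd).
Qed.

End L2_theory.

(** * Smooth functions and test functions *)

Section smooth_theory.
Context {R : realType} {n : nat}.
Local Notation V := 'rV[R]_n.
Implicit Types (f g F phi : V -> R) (s : seq 'I_n) (x b : V) (a c : R).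

(** Partial derivatives of all orders at a point depend on the germ only. *)
Lemma foldr_partial_near f g s x : (\forall y \near x, f y = g y) ->
  \forall y \near x, foldr partial f s y = foldr partial g s y.
Proof.
move=> fg; elim: s => [//|i s IH] /=.
move/nbhs_interior : IH; apply: filterS => y fgy.
exact: near_eq_derive.
Qed.

Lemma partial_near f g i x : (\forall y \near x, f y = g y) ->
  partial i f x = partial i g x.
Proof. exact: near_eq_derive. Qed.

(** Derivatives depend on the germ only. This serves to glue a test function with
the zero function. *)
Lemma smooth_local f :
  (forall x, exists2 g, smooth g & \forall y \near x, f y = g y) -> smooth f.
Proof.
move=> loc s; split => [x|i x]; have [g sg /(foldr_partial_near s) fg] := loc x;
  have [cg dg] := sg s.
  rewrite /continuous_at/= (nbhs_singleton fg).
  by move=> S /(cg x) nS; apply: (@filterS2 _ (nbhs x) (nbhs_filter x) _ _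
    (foldr partial f s @^-1` S) _ fg nS) => y /= ->.
by apply: near_eq_derivable (dg i x); apply: filterS fg => y ->.
Qed.

Lemma foldr_partial_cst0 s : foldr partial (cst 0 : V -> R) s = cst 0.
Proof.
by elim: s => [//|i s /= ->]; apply/funext => x; exact: derive_cst.
Qed.

Lemma smooth_cst0 : smooth (cst 0 : V -> R).
Proof.
move=> s; rewrite foldr_partial_cst0; split; first exact: cst_continuous.
by move=> i x; exact: derivable_cst.
Qed.

(** The difference quotient of [F \o aff a b] with step [h] is [a] times that of
[F] with step [a * h]. The factor [c] lets the statement be iterated. *)
Lemma is_derive_aff F a b c x v : 0 < a -> derivable F (aff a b x) v ->
  is_derive x v (fun y => c * F (aff a b y)) (c * a * 'D_v F (aff a b x)).
Proof.
move=> a0 dF.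
set Q := fun h => h^-1 *: ((F \o shift (aff a b x)) (h *: v) - F (aff a b x)).
have QL : Q @ 0^' --> 'D_v F (aff a b x) by exact: dF.
pose q (h : R) := h^-1 *: (((fun y => c * F (aff a b y)) \o shift x) (h *: v) -
  c * F (aff a b x)).
have qQ : q = fun h => c * a * Q (a * h).
  apply/funext => h; rewrite /q /Q /=.
  have -> : aff a b (h *: v + x) = (a * h) *: v + aff a b x.
    by rewrite /aff scalerDr scalerA addrA.
  rewrite /GRing.scale/= invfM -mulrBr !mulrA; congr (_ * _).
  by rewrite mulfK ?gt_eqF// mulrC.
have ah : (fun h : R => a * h) @ 0^' --> 0^'.
  move=> S [e /= e0 eS]; exists (e / a); first by rewrite /= divr_gt0.
  move=> h /=; rewrite sub0r normrN ltr_pdivlMr// => he h0; apply: eS => /=.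
    by rewrite sub0r normrN normrM (gtr0_norm a0) mulrC.
  by rewrite mulf_neq0// gt_eqF.
have qL : q @ 0^' --> c * a * 'D_v F (aff a b x).
  rewrite qQ; apply: cvgM; first exact: cvg_cst.
  exact: cvg_comp ah QL.
apply: DeriveDef; first by apply/cvg_ex; eexists; exact: qL.
exact/cvg_lim.
Qed.

Lemma continuous_aff a b : continuous (aff a b : V -> V).
Proof.
move=> x; apply: (@continuousD _ _ _ ( *:%R a) (cst b) x).
  exact: scaler_continuous.
exact: cst_continuous.
Qed.

Lemma foldr_partial_aff f a b s : 0 < a -> smooth f ->
  foldr partial (f \o aff a b) s =
  (fun x => a ^+ size s * foldr partial f s (aff a b x)).
Proof.
move=> a0 sf; elim: s => [|i s IH] /=.
  by apply/funext => x; rewrite mul1r.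
rewrite IH; apply/funext => x; have [_ /(_ i (aff a b x)) d] := sf s.
have [_ e] := is_derive_aff (a ^+ size s) a0 d.
by rewrite /partial [LHS]e exprSr.
Qed.

Lemma smooth_aff f a b : 0 < a -> smooth f -> smooth (f \o aff a b).
Proof.
move=> a0 sf s; rewrite foldr_partial_aff//; have [cf df] := sf s; split.
  move=> x; apply: (@continuousM _ _ (cst (a ^+ size s))
    (foldr partial f s \o aff a b) x); first exact: cst_continuous.
  by apply: continuous_comp; [exact: continuous_aff|exact: cf].
by move=> i x; have [] := is_derive_aff (a ^+ size s) a0 (df i (aff a b x)).
Qed.

Lemma partial_aff f a b i x : 0 < a -> smooth f ->
  partial i (f \o aff a b) x = a * partial i f (aff a b x).
Proof.
by move=> a0 sf; rewrite -[LHS]/(foldr partial (f \o aff a b) [:: i] x) foldr_partial_aff.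
Qed.

Lemma smooth_continuous_partial f i : smooth f -> continuous (partial i f).
Proof. by move=> sf; have [] := sf [:: i]. Qed.

Lemma smooth_continuous f : smooth f -> continuous f.
Proof. by move=> sf; have [] := sf [::]. Qed.

Lemma test_function_closed (Omega : set V) phi : test_function Omega phi ->
  exists K, [/\ compact K, closed K, K `<=` Omega &
    forall x, ~ K x -> \forall y \near x, phi y = 0].
Proof.
move=> [_ [K [cK KO K0]]]; have clK : closed K by exact: compact_closed.
exists K; split => // x nKx.
have /open_nbhs_nbhs : open_nbhs x (~` K) by split => //; exact: closed_openC.
by apply: filterS => y; exact: K0.
Qed.

Lemma test_function_partial0 (Omega : set V) phi i x :
  test_function Omega phi -> ~ Omega x -> partial i phi x = 0.
Proof.
move=> /test_function_closed[K [_ _ KO K0]] nOx.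
rewrite (@partial_near _ (cst 0)) ?/partial ?derive_cst//.
by apply: K0 => /KO.
Qed.

Lemma test_function_sub (A Omega : set V) phi : A `<=` Omega ->
  test_function A phi -> test_function Omega phi.
Proof.
move=> AO [sphi [K [cK KA K0]]]; split=> //; exists K; split => //.
exact: subset_trans AO.
Qed.

(** A test function on a disjoint union of open sets can be cut off outside one of
them: its support splits into two compact sets, because [K `&` A] is also
[K `\` B]. *)
Lemma test_function_restrict (A B : set V) phi : open A -> open B ->
  A `&` B = set0 -> test_function (A `|` B) phi -> test_function A (phi \_ A).
Proof.
move=> oA oB AB0 [sphi [K [cK KAB K0]]].
have cKA : compact (K `&` A).
  have -> : K `&` A = K `&` ~` B.
    apply/seteqP; split => x [Kx h]; split => //.
      by move=> Bx; have : (A `&` B) x by []; rewrite AB0.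
    by have [|/h] := KAB _ Kx.
  by apply: compact_closedI => //; exact: open_closedC.
have z x : ~ (K `&` A) x -> (phi \_ A) x = 0.
  move=> nKA; rewrite patchE; case: ifPn => //; rewrite inE => Ax.
  by apply: K0 => Kx; exact: nKA.
split; last by exists (K `&` A); split => // x [].
apply: smooth_local => x; have [Ax|nAx] := pselect (A x).
  exists phi => //; have : nbhs x A by exact: open_nbhs_nbhs.
  by apply: filterS => y Ay; rewrite patchE mem_set.
exists (cst 0); first exact: smooth_cst0.
have /open_nbhs_nbhs : open_nbhs x (~` (K `&` A)).
  split; last by case.
  by apply: closed_openC; exact: compact_closed.
by apply: filterS => y; exact: z.
Qed.

Lemma partial_restrict (A : set V) phi i x : open A -> A x ->
  partial i (phi \_ A) x = partial i phi x.
Proof.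
move=> oA Ax; apply: partial_near; have : nbhs x A by exact: open_nbhs_nbhs.
by apply: filterS => y Ay; rewrite patchE mem_set.
Qed.

Lemma test_function_aff (Omega : set V) phi a b : 0 < a ->
  test_function Omega phi ->
  test_function (aff a b @^-1` Omega) (phi \o aff a b).
Proof.
move=> a0 [sphi [K [cK KO K0]]]; split; first exact: smooth_aff.
exists (aff a^-1 (- (a^-1 *: b)) @` K); split.
- apply: continuous_compact => //; apply: continuous_subspaceT.
  exact: continuous_aff.
- by move=> _ [k Kk <-] /=; rewrite affVK//; exact: KO.
- move=> x nK; apply: K0 => Kx; apply: nK; exists (aff a b x) => //.
  by rewrite affK.
Qed.

End smooth_theory.

(** * Sobolev functions: restriction, zero extension, dilation *)

Section transfer.
Context {R : realType} {n : nat}.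
Local Notation V := 'rV[R]_n.
Local Notation RR := (measurableTypeR R).
Local Notation leb := (@lebesgue_rV R n).
Implicit Types (A B Omega : set V) (u v phi : V -> R) (g h : 'I_n -> V -> R).
Implicit Types (a mu : R) (b : V).

Lemma L2_sub A Omega u : measurable A -> measurable Omega -> A `<=` Omega ->
  L2 Omega u -> L2 A u.
Proof.
move=> mA mO AO [mu iu]; split; first exact: measurable_funS mu.
exact: integrableS iu.
Qed.

(** Both sides are the integral over the whole space of one and the same function
extended by zero. *)
Lemma L2dot_sub A Omega u v : A `<=` Omega ->
  (forall x, Omega x -> ~ A x -> u x * v x = 0) ->
  L2dot Omega u v = L2dot A u v.
Proof.
move=> AO z; rewrite /L2dot Rintegral_mkcond [RHS]Rintegral_mkcond.
apply: eq_Rintegral => x _; rewrite !patchE.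
case: ifPn => [|nOx]; rewrite ?inE; last first.
  by rewrite ifN//; apply: contra nOx; rewrite !inE; exact: AO.
by move=> Ox; case: ifPn => //; rewrite notin_setE => nAx; rewrite z.
Qed.

Lemma L2dot_restrict A Omega u v : A `<=` Omega ->
  L2dot Omega (u \_ A) v = L2dot A u v.
Proof.
move=> AO; rewrite (L2dot_sub AO); last first.
  by move=> x _ nAx; rewrite patchE memNset// mul0r.
by apply: eq_Rintegral => x xA; rewrite patchE xA.
Qed.

Lemma L2_restrict A Omega u : measurable A -> measurable Omega ->
  A `<=` Omega -> L2 A u -> L2 Omega (u \_ A).
Proof.
move=> mA mO AO [mu iu]; have AOE : Omega `&` A = A by exact: setIidr.
split.
  by apply/measurable_restrict; rewrite ?AOE.
rewrite (_ : (fun x => _) = (fun x => (u x ^+ 2)%:E) \_ A).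
  by apply/integrable_restrict; rewrite ?AOE.
by apply/funext => x; rewrite !patchE; case: ifP => //; rewrite expr0n.
Qed.

(** Such a function is bounded, and [K] has finite measure. Applied to test functions
and to their derivatives. *)
Lemma L2_continuous_compact Omega f K : measurable Omega -> continuous f ->
  compact K -> K `<=` Omega -> (forall x, ~ K x -> f x = 0) -> L2 Omega f.
Proof.
move=> mO cf cK KO K0; have clK : closed K by exact: compact_closed.
have mK : measurable K.
  rewrite -(setCK K); apply: measurableC; apply: open_measurable_rV.
  exact: closed_openC.
have -> : f = f \_ K.
  apply/funext => x; rewrite patchE; case: ifPn => //.
  by rewrite notin_setE => /K0.
apply: L2_restrict => //; have mf := continuous_measurable_rV cf.
have mfK : measurable_fun K (f : V -> RR) by exact: measurable_funTS.
split => //.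
have fK : (leb K < +oo)%E.
  by apply: bounded_lebesgue_rV => //; exact: compact_bounded.
have mf2 : measurable_fun K (fun x => f x ^+ 2 : RR) by exact: measurable_funX.
apply: (measurable_bounded_integrable mK fK mf2).
have : compact ((fun x => f x ^+ 2) @` K).
  apply: continuous_compact => //; apply: continuous_subspaceT => x.
  by apply: (@continuousM _ _ f f x); exact: cf.
move=> /compact_bounded[M [Mr HM]]; exists M; split => // N MN x Kx /=.
by apply: HM MN _ _; exists x.
Qed.

Lemma L2_test_function Omega phi : measurable Omega ->
  test_function Omega phi -> L2 Omega phi.
Proof.
move=> mO [sphi [K [cK KO K0]]].
exact: (L2_continuous_compact mO (smooth_continuous sphi) cK KO K0).
Qed.

Lemma L2_test_partial Omega phi i : measurable Omega ->
  test_function Omega phi -> L2 Omega (partial i phi).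
Proof.
move=> mO tphi; have [sphi _] := tphi.
have [K [cK _ KO K0]] := test_function_closed tphi.
apply: (L2_continuous_compact mO _ cK KO); first exact: smooth_continuous_partial.
move=> x /K0 z; rewrite (@partial_near _ _ _ (cst 0))//.
by rewrite /partial derive_cst.
Qed.

(** Test functions on the smaller set are test functions on the larger one. *)
Lemma H1_grad_sub A Omega v h : open A -> open Omega -> A `<=` Omega ->
  H1_grad Omega v h -> H1_grad A v h.
Proof.
move=> oA oO AO [L2v gh].
have [mA mO] := (open_measurable_rV oA, open_measurable_rV oO).
split; first exact: L2_sub L2v.
move=> i; have [L2h wh] := gh i; split; first exact: L2_sub L2h.
move=> phi tphi; have := wh phi (test_function_sub AO tphi).
rewrite (L2dot_sub AO); last first.
  by move=> x _ nAx; rewrite (test_function_partial0 i tphi nAx) mulr0.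
rewrite (L2dot_sub AO)// => x _ nAx.
have [_ [K [_ KA K0]]] := tphi.
by rewrite K0 ?mulr0// => /KA.
Qed.

(** Extension by zero preserves [H^1] because the two pieces are open and disjoint:
every test function on the union can be cut off to one piece. *)
Lemma H1_grad_restrict A B u g : open A -> open B -> A `&` B = set0 ->
  H1_grad A u g -> H1_grad (A `|` B) (u \_ A) (fun i => g i \_ A).
Proof.
move=> oA oB AB0 [L2u gg].
have AAB : A `<=` A `|` B by move=> x; left.
have [mA mB] := (open_measurable_rV oA, open_measurable_rV oB).
have mAB : measurable (A `|` B) by exact: measurableU.
split; first exact: L2_restrict.
move=> i; have [L2g wg] := gg i; split; first exact: L2_restrict.
move=> phi tphi; rewrite !L2dot_restrict//.
have := wg _ (test_function_restrict oA oB AB0 tphi).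
rewrite (_ : L2dot A u _ = L2dot A u (partial i phi)); last first.
  by apply: eq_Rintegral => x; rewrite inE => Ax; rewrite partial_restrict.
move=> ->; congr (- _).
by apply: eq_Rintegral => x xA; rewrite patchE xA.
Qed.

(** Each function of the test space of the union restricts to one of the test space
of [A], where the equation of [u] applies; the integrands vanish elsewhere. *)
Lemma neumann_eigenfunction_restrict A B mu u : open A -> open B ->
  A `&` B = set0 -> neumann_eigenfunction A mu u ->
  neumann_eigenfunction (A `|` B) mu (u \_ A).
Proof.
move=> oA oB AB0 [u0 [g H1u weak]].
have AAB : A `<=` A `|` B by move=> x; left.
split.
  apply: contra_not u0; apply: filterS => x + Ax => /(_ (AAB _ Ax)).
  by rewrite patchE mem_set.
exists (fun i => g i \_ A); first exact: H1_grad_restrict.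
move=> v h H1v; rewrite L2dot_restrict//.
rewrite -(weak v h); first by apply: eq_bigr => i _; exact: L2dot_restrict.
by apply: H1_grad_sub H1v => //; exact: openU.
Qed.

Lemma aff_preimageK a b A : 0 < a ->
  aff a^-1 (- (a^-1 *: b)) @^-1` (aff a b @^-1` A) = A.
Proof. by move=> a0; apply/seteqP; split => x /=; rewrite affVK. Qed.

Lemma open_aff a b A : open A -> open (aff a b @^-1` A).
Proof. by move=> oA; have /continuousP := @continuous_aff R n a b; apply. Qed.

Lemma measurable_fun_aff a b A u : measurable A ->
  measurable_fun A (u : V -> RR) ->
  measurable_fun (aff a b @^-1` A) (u \o aff a b : V -> RR).
Proof.
move=> mA mu; apply: (measurable_comp mA) => //.
  by move=> _ [x Ax <-].
exact: measurable_funS (measurable_aff a b).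
Qed.

Lemma L2_aff a b A u : 0 < a -> measurable A -> L2 A u ->
  L2 (aff a b @^-1` A) (u \o aff a b).
Proof.
move=> a0 mA [mu iu]; split; first exact: measurable_fun_aff.
have mA' := measurable_aff_preimage a b mA.
have mu2 : measurable_fun A (fun x => u x ^+ 2 : RR) by exact: measurable_funX.
apply/integrableP; split.
  apply/measurable_EFinP; apply: measurable_funX.
  exact: measurable_fun_aff.
move/integrableP : iu => [_ iu].
rewrite (@ge0_integral_aff _ _ a b A (fun x => `|(u x ^+ 2)%:E|%E))//.
  by rewrite lte_mul_pinfty// lee_fin invr_ge0 exprn_ge0// ltW.
by apply: measurableT_comp => //; exact/measurable_EFinP.
Qed.

Lemma L2dot_aff a b A u v : 0 < a -> measurable A ->
  measurable_fun A (u : V -> RR) -> measurable_fun A (v : V -> RR) ->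
  L2dot (aff a b @^-1` A) (u \o aff a b) (v \o aff a b) =
  a ^- n * L2dot A u v.
Proof.
move=> a0 mA mu mv.
exact: (@Rintegral_aff _ _ a b A (fun x => u x * v x) a0 mA (measurable_funM mu mv)).
Qed.

(** A test function on the dilated set is the pullback of a test function on the
original one; the factors [a^-n] of the two integrals cancel. *)
Lemma H1_grad_aff a b A u g : 0 < a -> open A -> H1_grad A u g ->
  H1_grad (aff a b @^-1` A) (u \o aff a b)
    (fun i x => a * g i (aff a b x)).
Proof.
move=> a0 oA [L2u gg]; have mA := open_measurable_rV oA.
split; first exact: L2_aff.
have mA' := measurable_aff_preimage a b mA.
move=> i; have [L2g wg] := gg i; have L2g' := L2_aff b a0 mA L2g.
split; first exact: (L2Z mA' a L2g').
move=> phi tphi; pose a' := a^-1; pose b' := - (a^-1 *: b).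
have a'0 : 0 < a' by rewrite invr_gt0.
pose psi := phi \o aff a' b'.
have tpsi : test_function A psi.
  by have := test_function_aff b' a'0 tphi; rewrite aff_preimageK.
have phiE : phi = psi \o aff a b.
  by apply/funext => x; rewrite /psi /= affK.
have [[mu _] [mg _]] := (L2u, L2g); have [spsi _] := tpsi.
have [[mpsi _] [mdpsi _]] := (L2_test_function mA tpsi, L2_test_partial i mA tpsi).
have L2u' := L2_aff b a0 mA L2u.
have L2psi := L2_aff b a0 mA (L2_test_function mA tpsi).
have L2dpsi := L2_aff b a0 mA (L2_test_partial i mA tpsi).
have -> : partial i phi = fun x => a * (partial i psi \o aff a b) x.
  by apply/funext => x; rewrite phiE partial_aff.
rewrite phiE L2dotC L2dotZl// L2dotC L2dot_aff// wg//.
by rewrite L2dotZl// L2dot_aff// !mulrN.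
Qed.

(** The quadratic form scales as [a^2] relative to the [L^2] norm. Any [v] in the
test space of the dilated set is the pullback of [v \o (aff a b)^-1], to which
the original eigenvalue equation applies. *)
Lemma neumann_eigenfunction_aff a b A mu u : 0 < a -> open A ->
  neumann_eigenfunction A mu u ->
  neumann_eigenfunction (aff a b @^-1` A) (a ^+ 2 * mu) (u \o aff a b).
Proof.
move=> a0 oA [u0 [g H1u weak]]; have mA := open_measurable_rV oA.
have a'0 : 0 < a^-1 by rewrite invr_gt0.
have mA' := measurable_aff_preimage a b mA.
have [L2u L2g] := H1u.
split.
  apply: contra_not u0 => -[N [mN N0 uN]].
  exists (aff a^-1 (- (a^-1 *: b)) @^-1` N); split.
  - exact: measurable_aff_preimage.
  - by rewrite lebesgue_rV_aff// N0 mule0.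
  - move=> x /= h; apply: uN => /= h'; apply: h => Ax.
    by have := h'; rewrite affVK//; apply.
exists (fun i x => a * g i (aff a b x)); first exact: H1_grad_aff.
move=> v h H1v; pose v' := v \o aff a^-1 (- (a^-1 *: b)).
pose h' i x := a^-1 * h i (aff a^-1 (- (a^-1 *: b)) x).
have H1v' : H1_grad A v' h'.
  have := H1_grad_aff (- (a^-1 *: b)) a'0 (@open_aff a b A oA) H1v.
  by rewrite aff_preimageK.
have vE : v = v' \o aff a b by apply/funext => x; rewrite /v' /= affK.
have hE i : h i = fun x => a * (h' i \o aff a b) x.
  by apply/funext => x; rewrite /h' /= affK// mulrA mulfV ?gt_eqF// mul1r.
have [L2v' L2h'] := H1v'.
have [mu0 mv0] := (proj1 L2u, proj1 L2v').
rewrite {1}vE L2dot_aff// mulrCA -mulrA -(weak _ _ H1v') !mulr_sumr.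
apply: eq_bigr => i _.
have L2gi := L2_aff b a0 mA (proj1 (L2g i)).
have L2hi := L2_aff b a0 mA (proj1 (L2h' i)).
rewrite hE L2dotZl//; last exact: L2Z.
rewrite L2dotC L2dotZl// L2dotC L2dot_aff//; [|exact: (proj1 (proj1 (L2g i)))|
  exact: (proj1 (proj1 (L2h' i)))].
by ring.
Qed.

End transfer.

(** * Constants are eigenfunctions *)

Section constants.
Context {R : realType} {n : nat}.
Local Notation V := 'rV[R]_n.
Local Notation RR := (measurableTypeR R).
Local Notation leb := (@lebesgue_rV R n).
Implicit Types (A Omega : set V) (phi : V -> R).

Lemma is_derive_line phi (x v : V) (t : R) : derivable phi (t *: v + x) v ->
  is_derive t (1 : R) (fun s => phi (s *: v + x)) ('D_v phi (t *: v + x)).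
Proof.
move=> dphi; set L := 'D_v phi _.
have h : (fun h : R => h^-1 *: (((fun s => phi (s *: v + x)) \o shift t) (h *: 1) -
    phi (t *: v + x))) @ 0^' --> L.
  rewrite (_ : (fun h : R => _) = fun h => h^-1 *:
    ((phi \o shift (t *: v + x)) (h *: v) - phi (t *: v + x))); first exact: dphi.
  by apply/funext => h /=; rewrite [h *: 1]mulr1 scalerDl addrA.
by apply: DeriveDef; [apply/cvg_ex; exists L|exact/cvg_lim].
Qed.

(** The mean value theorem along the line of direction [v]. *)
Lemma increment_le phi (v : V) (M h : R) : 0 < h ->
  (forall x, derivable phi x v) -> (forall x, `|'D_v phi x| <= M) ->
  forall x, `|phi (h *: v + x) - phi x| <= M * h.
Proof.
move=> h0 dphi phiM x.
have dline t := is_derive_line (dphi (t *: v + x)).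
have [|t _] := @MVT R (fun s => phi (s *: v + x)) _ 0 h h0 (fun t _ => dline t).
  by apply: derivable_within_continuous => t _; have [] := dline t.
by rewrite scale0r add0r subr0 => ->; rewrite normrM (gtr0_norm h0) ler_pM2r.
Qed.

Lemma Rintegral_translate phi (b : V) : measurable_fun setT (phi : V -> RR) ->
  \int[leb]_x phi (x + b) = \int[leb]_x phi x.
Proof.
move=> mphi; have := Rintegral_aff b ltr01 measurableT mphi.
rewrite expr1n invr1 mul1r preimage_setT => <-.
by apply: eq_Rintegral => x _; rewrite /aff scale1r.
Qed.

(** By translation invariance every difference quotient of [phi] has integral zero,
and the quotients with step [1/(m+1)] converge boundedly to [partial i phi],
all supported in a fixed ball, so dominated convergence applies. *)
Lemma Rintegral_partial0 Omega phi i : test_function Omega phi ->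
  \int[leb]_(x in Omega) partial i phi x = 0.
Proof.
move=> tphi; have [sphi _] := tphi.
have [K [cK clK KO K0]] := test_function_closed tphi.
have phi0 x : ~ K x -> phi x = 0 by move=> /K0 /nbhs_singleton.
have dphi0 x : ~ K x -> partial i phi x = 0.
  move=> /K0 z; rewrite (@partial_near _ _ _ (cst 0))//.
  by rewrite /partial derive_cst.
have cdphi := smooth_continuous_partial sphi (i := i).
have mphi := continuous_measurable_rV (smooth_continuous sphi).
have mdphi := continuous_measurable_rV cdphi.
have [_ dphi] := sphi [::].
transitivity (\int[leb]_x partial i phi x).
  rewrite Rintegral_mkcond; apply: eq_Rintegral => x _; rewrite patchE.
  case: ifPn => //; rewrite notin_setE => nOx.
  by rewrite dphi0// => /KO.
have [r r0 rP] : exists2 r : R, 0 < r & forall x, K x -> `|x| <= r.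
  have [r [_ rP]] := compact_bounded cK.
  exists (`|r| + 1); first by rewrite ltr_wpDl.
  by apply: rP; rewrite (le_lt_trans (ler_norm r))// ltrDl.
have [M MP] : exists M : R, forall x, `|partial i phi x| <= M.
  have /compact_bounded[M [_ MP]] : compact (partial i phi @` K).
    by apply: continuous_compact => //; exact: continuous_subspaceT.
  exists (`|M| + 1) => x; have [Kx|/dphi0 ->] := pselect (K x).
    apply: (MP (`|M| + 1)); last by exists x.
    by rewrite (le_lt_trans (ler_norm M))// ltrDl.
  by rewrite normr0 addr_ge0.
have M0 : 0 <= M by apply: le_trans (MP 0).
pose e : V := delta_mx ord0 i.
(* A point [x] with [x + h *: e] in [K], for [0 < h <= 1], has norm at most
   [r + `|e|]. *)
pose B : set V := ball 0 (r + `|e| + 1).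
have mB : measurable B by apply: open_measurable_rV; exact: ball_open.
have KB x : K x -> B x.
  move=> /rP xr; rewrite /B -ball_normE/= sub0r normrN (le_lt_trans xr)//.
  by rewrite -addrA ltrDl ltr_wpDl.
have fB : (leb B < +oo)%E.
  apply: bounded_lebesgue_rV => //; exists (r + `|e| + 1); split; first exact: num_real.
  move=> N rN x; rewrite /B -ball_normE/= sub0r normrN => /ltW xr.
  exact: le_trans xr (ltW rN).
have iphit b : leb.-integrable setT (fun x => (phi (x + b))%:E).
  have L2phi : L2 setT phi.
    exact: (L2_continuous_compact measurableT (smooth_continuous sphi) cK).
  have L2B : L2 setT ((cst 1%R : V -> R) \_ B).
    by apply: L2_restrict => //; exact: L2_cst.
  have L2pt := L2_aff b ltr01 measurableT L2phi.
  have L2Bt := L2_aff b ltr01 measurableT L2B.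
  rewrite preimage_setT in L2pt L2Bt.
  apply: eq_integrable (L2_integrableM measurableT L2pt L2Bt) => // x _ /=.
  rewrite /aff scale1r patchE; case: ifPn => /=; first by rewrite mulr1.
  by rewrite notin_setE => nBx; rewrite phi0 ?mul0r// => /KB.
have iphi : leb.-integrable setT (EFin \o phi).
  by apply: eq_integrable (iphit 0) => // x _; rewrite addr0.
pose q (m : nat) (x : V) : R := m.+1%:R * (phi (x + m.+1%:R^-1 *: e) - phi x).
have mq m : measurable_fun setT (q m : V -> RR).
  apply: measurable_funM => //; apply: measurable_funB => //.
  rewrite (_ : (fun x => _) = phi \o aff 1 (m.+1%:R^-1 *: e)).
    by apply: measurableT_comp => //; exact: measurable_aff.
  by apply/funext => x; rewrite /= /aff scale1r.
have idq b : leb.-integrable setT (EFin \o (fun x => phi (x + b) - phi x)).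
  exact: eq_integrable (integrableB measurableT (iphit b) iphi).
have q0 m : \int[leb]_x q m x = 0.
  rewrite (RintegralZl m.+1%:R measurableT (idq (m.+1%:R^-1 *: e))).
  rewrite (RintegralB measurableT (iphit _) iphi).
  by rewrite (Rintegral_translate _ mphi) subrr mulr0.
have iq m : leb.-integrable setT (EFin \o q m).
  by apply: eq_integrable (integrableZl measurableT m.+1%:R (idq _)).
have qf x : q ^~ x @ \oo --> partial i phi x.
  have dx : (fun h : R => h^-1 *: ((phi \o shift x) (h *: e) - phi x)) @ 0^' -->
      partial i phi x by exact: (dphi i x).
  have h0 : (fun m : nat => m.+1%:R^-1 : R) @ \oo --> (0 : R)^'.
    move=> S nS; have : \forall m \near \oo, harmonic m != 0 :> R -> S (harmonic m).
      exact: (@cvg_harmonic R _ nS).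
    change ((\forall m \near \oo, harmonic m != 0 :> R -> S (harmonic m)) ->
      \forall m \near \oo, S (harmonic m)).
    by apply: filterS => m; apply; rewrite invr_eq0 pnatr_eq0.
  rewrite (_ : q ^~ x = (fun h : R => h^-1 *: ((phi \o shift x) (h *: e) - phi x))
    \o (fun m : nat => m.+1%:R^-1)); first exact: cvg_comp h0 dx.
  by apply/funext => m; rewrite /q /= (addrC x) invrK.
have qM m x : `|q m x| <= M.
  have m0 : 0 < m.+1%:R^-1 :> R by rewrite invr_gt0.
  rewrite /q normrM normr_nat -ler_pdivlMl// [leRHS]mulrC (addrC x).
  exact: (increment_le m0 (dphi i) MP).
have q0B m x : ~ B x -> q m x = 0.
  move=> nBx; rewrite /q !phi0 ?subrr ?mulr0//; first by move=> /KB.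
  move=> /rP xr; apply: nBx; rewrite /B -ball_normE/= sub0r normrN.
  have : `|x| <= `|x + m.+1%:R^-1 *: e| + `|m.+1%:R^-1 *: e|.
    by rewrite -{1}(addrK (m.+1%:R^-1 *: e) x) ler_normB.
  rewrite normrZ gtr0_norm ?invr_gt0// => /le_lt_trans; apply.
  rewrite -addrA ler_ltD// ltr_pwDr//.
  by rewrite ler_piMl// invf_le1// ler1n.
have ig : leb.-integrable setT ((cst M%:E : V -> \bar R) \_ B).
  apply/(integrable_mkcond _ mB).
  have bM : [bounded (cst M : V -> R) x | x in B].
    by exists M; split; [exact: num_real|move=> N MN x _ /=; rewrite ger0_norm// ltW].
  exact: (measurable_bounded_integrable mB fB (measurable_cst _) bM).
have [] := @dominated_convergence _ _ _ leb setT measurableT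
  (fun m => EFin \o q m) (EFin \o partial i phi) ((cst M%:E : V -> \bar R) \_ B).
- by move=> m; apply/measurable_EFinP; exact: mq.
- by apply/measurable_EFinP; exact: mdphi.
- by apply: aeW => x _; apply: cvg_EFin; [exact: nearW|exact: qf].
- exact: ig.
- apply: aeW => x m _ /=; rewrite patchE; case: ifPn => [_|].
    by rewrite lee_fin.
  by rewrite notin_setE => /q0B ->; rewrite normr0.
move=> idphi _ cv; rewrite /Rintegral.
have z : [sequence (\int[leb]_x (EFin \o q m) x)%E]_m = (fun=> 0%E).
  apply/funext => m /=; rewrite -[RHS]/((0 : R)%:E) -(q0 m) /Rintegral fineK//.
  exact: (integrable_fin_num _ (iq m)).
by rewrite z in cv; rewrite -(cvg_lim _ cv)// lim_cst.
Qed.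

(** By [Rintegral_partial0] the zero field is a weak gradient of the constant, so both
sides of the eigenvalue equation vanish. *)
Lemma neumann_eigenfunction_cst A : open A -> (leb A < +oo)%E ->
  ~ (\forall x \ae leb, ~ A x) -> neumann_eigenfunction A 0 (cst 1).
Proof.
move=> oA fA nA; have mA := open_measurable_rV oA; split.
  apply: contra_not nA; apply: filterS => x h Ax.
  by have /eqP := h Ax; rewrite oner_eq0.
exists (fun _ => cst 0).
  split; first exact: L2_cst.
  move=> i; split; first exact: L2_cst0.
  move=> phi tphi; rewrite /L2dot.
  rewrite (_ : \int[leb]_(x in A) (cst 0 x * phi x) = 0); last first.
    rewrite -[RHS](mul0r (fine (leb A))) -Rintegral_cst//.
    by apply: eq_Rintegral => x _; rewrite mul0r.
  rewrite oppr0 -(Rintegral_partial0 i tphi).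
  by apply: eq_Rintegral => x _; rewrite mul1r.
move=> v h H1v; rewrite mul0r big1// => i _.
have -> : L2dot A (cst 0) (h i) = L2dot A (fun x => 0 * h i x) (h i).
  by apply: eq_Rintegral => x _; rewrite !mul0r.
by have [_ /(_ i)[L2h _]] := H1v; rewrite L2dotZl// mul0r.
Qed.

End constants.

(** * Eigenbases and the counting function *)

Section eigenbasis.
Context {R : realType} {n : nat}.
Local Notation V := 'rV[R]_n.
Local Notation leb := (@lebesgue_rV R n).
Implicit Types (A B Omega : set V) (u v : V -> R) (mu lambda a c : R) (b : V).

(** The witnesses of [discrete_neumann_spectrum], named so that they can be
transported. *)
Definition eigenbasis Omega (w : nat -> V -> R) (lam : nat -> R) :=
  [/\ forall j, neumann_eigenfunction Omega (lam j) (w j),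
      forall i j, L2dot Omega (w i) (w j) = (i == j)%:R,
      forall f, L2 Omega f -> (forall j, L2dot Omega f (w j) = 0) ->
        \forall x \ae leb, Omega x -> f x = 0
    & lam j @[j --> \oo] --> +oo].

Lemma neumann_eigenfunction_L2 Omega mu u :
  neumann_eigenfunction Omega mu u -> L2 Omega u.
Proof. by move=> [_ [g []]]. Qed.

Lemma neumann_eigenfunction_scale Omega mu u c : measurable Omega -> c != 0 ->
  neumann_eigenfunction Omega mu u ->
  neumann_eigenfunction Omega mu (fun x => c * u x).
Proof.
move=> mO c0 [u0 [g [L2u H1u] weak]]; split.
  apply: contra_not u0; apply: filterS => x h /h /eqP.
  by rewrite mulf_eq0 (negbTE c0) => /eqP.
exists (fun i x => c * g i x).
  split; first exact: L2Z.
  move=> i; have [L2g wg] := H1u i; split; first exact: L2Z.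
  move=> phi tphi; have := wg phi tphi.
  rewrite L2dotZl//; last exact: L2_test_partial.
  move=> ->; rewrite L2dotZl ?mulrN//; exact: L2_test_function.
move=> v h H1v; have [L2v H1h] := H1v.
rewrite L2dotZl// mulrCA -(weak v h)// mulr_sumr; apply: eq_bigr => i _.
by rewrite L2dotZl//; [case: (H1u i)|case: (H1h i)].
Qed.

Lemma neumann_eigenfunction_ge0 Omega mu u : measurable Omega ->
  neumann_eigenfunction Omega mu u -> 0 <= mu.
Proof.
move=> mO eu; have L2u := neumann_eigenfunction_L2 eu.
have [u0 [g H1u weak]] := eu; have uu := L2dot_self_gt0 mO L2u u0.
rewrite -(pmulr_lge0 _ uu) -(weak u g)// sumr_ge0// => i _.
by apply: Rintegral_ge0 => x _; rewrite -expr2 sqr_ge0.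
Qed.

(** Testing each eigenvalue equation against the other eigenfunction gives
[mu <u,v> = lambda <u,v>]. *)
Lemma neumann_eigenfunction_orth Omega mu lambda u v :
  neumann_eigenfunction Omega mu u -> neumann_eigenfunction Omega lambda v ->
  mu != lambda -> L2dot Omega u v = 0.
Proof.
move=> [_ [g H1u weaku]] [_ [h H1v weakv]] ml; apply/eqP.
have : (mu - lambda) * L2dot Omega u v = 0.
  rewrite mulrBl -(weaku v h)// [in X in _ - X]L2dotC -(weakv u g)//.
  by apply/eqP; rewrite subr_eq0; apply/eqP/eq_bigr => i _; rewrite L2dotC.
by move=> /eqP; rewrite mulf_eq0 subr_eq0 (negbTE ml).
Qed.

Lemma eigenbasis_lin_indep Omega w lam N (f : 'I_N -> nat) :
  measurable Omega -> eigenbasis Omega w lam -> injective f ->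
  lin_indep_ae Omega (fun j => w (f j)).
Proof.
move=> mO [ew ow _ _] finj c c0 i.
have L2w j : L2 Omega (w j) by exact: neumann_eigenfunction_L2 (ew j).
have := L2dot_ae0 mO (L2_sum mO c (fun j => L2w (f j))) (L2w (f i)) c0.
rewrite L2dot_suml// (bigD1 i)//= ow eqxx mulr1 big1 ?addr0// => j ji.
by rewrite ow (inj_eq finj) (negbTE ji) mulr0.
Qed.

(** An eigenfunction of eigenvalue at most [mu] is orthogonal to all [w m] with
[lam m > mu], so it is determined by its coordinates on the finitely many others;
more than that many such eigenfunctions admit a nontrivial linear combination
that is orthogonal to the whole basis, hence vanishes almost everywhere. *)
Lemma neumann_count_geP Omega w lam N mu :
  measurable Omega -> eigenbasis Omega w lam ->
  neumann_count_ge Omega N mu <->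
  exists2 f : 'I_N -> nat, injective f & forall j, lam (f j) <= mu.
Proof.
move=> mO bw; have [ew ow cw lamoo] := bw.
have L2w j : L2 Omega (w j) by exact: neumann_eigenfunction_L2 (ew j).
split; last first.
  move=> [f finj fmu]; exists (fun j => w (f j)), (fun j => lam (f j)).
  by split => //; exact: eigenbasis_lin_indep finj.
move=> [u [nu [eu iu]]].
have [K _ KP] : \forall m \near \oo, mu + 1 <= lam m by move/cvgryPge : lamoo; apply.
pose s := [seq m <- iota 0 K | lam m <= mu].
have sP m : m \notin s -> mu < lam m.
  rewrite mem_filter mem_iota/= add0n negb_and -ltNge -leqNgt.
  by move=> /orP[//|/KP]; apply: lt_le_trans; rewrite ltrDl.
have us : uniq s by rewrite filter_uniq// iota_uniq.
have L2u j : L2 Omega (u j) by exact: neumann_eigenfunction_L2 (proj1 (eu j)).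
have [Ns|sN] := leqP N (size s).
  exists (fun j : 'I_N => nth 0%N s j).
    move=> i j /eqP; rewrite nth_uniq// ?(leq_trans _ Ns)//.
    by move=> /eqP/val_inj.
  move=> j; have : nth 0%N s j \in s by rewrite mem_nth// (leq_trans _ Ns).
  by rewrite mem_filter => /andP[].
(* The coordinates of the [u j] on the part of the basis below [mu]; a vector
   of the left kernel gives the vanishing combination. *)
pose M : 'M[R]_(N, size s) := \matrix_(j, m) L2dot Omega (u j) (w (nth 0%N s m)).
have : kermx M != 0.
  rewrite kermx_eq0 /row_free neq_ltn (leq_ltn_trans (rank_leq_col M))//.
move=> /rowV0Pn[c /sub_kermxP cM c0].
have /rowP c00 : c = 0.
  apply/rowP => j; rewrite mxE; apply: (iu (c 0)).
  apply: cw; first exact: L2_sum.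
  move=> m; rewrite L2dot_suml//.
  have [ms|/sP lm] := boolP (m \in s).
    have ims : (index m s < size s)%N by rewrite index_mem.
    have /rowP/(_ (Ordinal ims)) := cM; rewrite !mxE => e; rewrite -[RHS]e.
    by apply: eq_bigr => i _; rewrite mxE nth_index.
  rewrite big1// => i _; have [eui nui] := eu i.
  rewrite (neumann_eigenfunction_orth eui (ew m)) ?mulr0//.
  by rewrite lt_eqF// (le_lt_trans nui).
by case/eqP: c0; apply/rowP => j; rewrite c00.
Qed.

Definition interleave T (f g : nat -> T) j := if odd j then g j./2 else f j./2.

(** Spectrum of a disjoint union: the two eigenbases, extended by zero and
interleaved, form an eigenbasis of the union. A function orthogonal to all of it
vanishes on each component. *)
Lemma eigenbasisU A B (u v : nat -> V -> R) (lam mu : nat -> R) :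
  open A -> open B -> A `&` B = set0 ->
  eigenbasis A u lam -> eigenbasis B v mu ->
  eigenbasis (A `|` B)
    (interleave (fun j => u j \_ A) (fun j => v j \_ B)) (interleave lam mu).
Proof.
move=> oA oB AB0 [eu ou cu luoo] [ev ov cv lvoo].
have BA0 : B `&` A = set0 by rewrite setIC.
have AAB : A `<=` A `|` B by move=> x; left.
have BAB : B `<=` A `|` B by move=> x; right.
have [mA mB] := (open_measurable_rV oA, open_measurable_rV oB).
have mAB : measurable (A `|` B) by exact: measurableU.
have uv i j : L2dot (A `|` B) (u i \_ A) (v j \_ B) = 0.
  rewrite L2dot_restrict// -[RHS](mul0r (L2dot A (cst 0) (cst 0))).
  transitivity (L2dot A (cst 0) (cst 0) : R); last first.
    by rewrite mul0r /L2dot; under eq_Rintegral do rewrite mul0r;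
      rewrite Rintegral_cst// mul0r.
  apply: eq_Rintegral => x; rewrite inE => Ax; rewrite patchE memNset ?mulr0//.
  by move=> Bx; have : (A `&` B) x by []; rewrite AB0.
split.
- move=> j; rewrite /interleave; case: ifP => _.
    by rewrite setUC; exact: neumann_eigenfunction_restrict.
  exact: neumann_eigenfunction_restrict.
- move=> i j; rewrite /interleave; have [oi|oi] := ifPn; have [oj|oj] := ifPn.
  + rewrite L2dot_restrict//; transitivity (L2dot B (v i./2) (v j./2)).
      by apply: eq_Rintegral => x xB; rewrite patchE xB.
    rewrite ov; congr (nat_of_bool _)%:R; apply/eqP/eqP => [e|-> //].
    by rewrite -(odd_double_half i) -(odd_double_half j) oi oj e.
  + rewrite L2dotC uv; case: eqVneq => // ij.
    by rewrite -ij oi in oj.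
  + by rewrite uv; case: eqVneq => // ij; rewrite ij oj in oi.
  + rewrite L2dot_restrict//; transitivity (L2dot A (u i./2) (u j./2)).
      by apply: eq_Rintegral => x xB; rewrite patchE xB.
    rewrite ou; congr (nat_of_bool _)%:R; apply/eqP/eqP => [e|-> //].
    by rewrite -(odd_double_half i) -(odd_double_half j) (negbTE oi) (negbTE oj) e.
- move=> f L2f f0.
  have fA : \forall x \ae leb, A x -> f x = 0.
    apply: cu => [|j]; first exact: L2_sub L2f.
    have := f0 j.*2; rewrite /interleave odd_double doubleK.
    by rewrite L2dotC L2dot_restrict// L2dotC.
  have fB : \forall x \ae leb, B x -> f x = 0.
    apply: cv => [|j]; first exact: L2_sub L2f.
    have := f0 j.*2.+1; rewrite /interleave/= odd_double/= uphalf_double.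
    by rewrite L2dotC L2dot_restrict// L2dotC.
  by apply: filterS2 fA fB => x fAx fBx [/fAx|/fBx].
- apply/cvgryPge => M.
  have [K1 _ K1P] : \forall m \near \oo, M <= lam m by move/cvgryPge : luoo; apply.
  have [K2 _ K2P] : \forall m \near \oo, M <= mu m by move/cvgryPge : lvoo; apply.
  exists (maxn K1 K2).*2 => // j /=; rewrite -geq_half_double geq_max.
  by move=> /andP[j1 j2]; rewrite /interleave; case: ifP => _; [exact: K2P|exact: K1P].
Qed.

(** The factor [Num.sqrt (a ^+ n)] restores the normalization, as the change of
variables multiplies inner products by [a^-n]. *)
Lemma eigenbasis_aff a b A w lam : 0 < a -> open A -> eigenbasis A w lam ->
  eigenbasis (aff a b @^-1` A)
    (fun j x => Num.sqrt (a ^+ n) * w j (aff a b x)) (fun j => a ^+ 2 * lam j).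
Proof.
move=> a0 oA [ew ow cw lamoo]; have mA := open_measurable_rV oA.
have an0 : 0 < a ^+ n by rewrite exprn_gt0.
have c0 : Num.sqrt (a ^+ n) != 0 by rewrite gt_eqF// sqrtr_gt0.
have mA' := measurable_aff_preimage a b mA.
have L2w j : L2 A (w j) by exact: neumann_eigenfunction_L2 (ew j).
have L2w' j : L2 (aff a b @^-1` A) (w j \o aff a b) by exact: L2_aff.
split.
- move=> j; apply: (neumann_eigenfunction_scale mA' c0).
  exact: neumann_eigenfunction_aff.
- move=> i j; rewrite (L2dotZl mA' _ (L2w' i) (L2Z mA' _ (L2w' j))).
  rewrite L2dotC L2dotZl// mulrA -expr2 sqr_sqrtr ?ltW//.
  rewrite L2dot_aff//; [|exact: (proj1 (L2w j))|exact: (proj1 (L2w i))].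
  by rewrite mulVKf ?ow 1?eq_sym// eq_sym gt_eqF.
- move=> f L2f f0; have a'0 : 0 < a^-1 by rewrite invr_gt0.
  pose f' := f \o aff a^-1 (- (a^-1 *: b)).
  have fE : f = f' \o aff a b by apply/funext => x; rewrite /f' /= affK.
  have L2f' : L2 A f'.
    by have := L2_aff (- (a^-1 *: b)) a'0 mA' L2f; rewrite aff_preimageK.
  have : \forall x \ae leb, A x -> f' x = 0.
    apply: cw => // j; have := f0 j.
    rewrite L2dotC (L2dotZl mA' _ (L2w' j) L2f) L2dotC fE.
    rewrite L2dot_aff//; [|exact: (proj1 L2f')|exact: (proj1 (L2w j))].
    move=> /eqP; rewrite mulf_eq0 (negbTE c0)/= mulf_eq0 invr_eq0.
    by rewrite (gt_eqF an0)/= => /eqP.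
  move=> [N [mN N0 fN]]; exists (aff a b @^-1` N); split.
  + exact: measurable_aff_preimage.
  + by rewrite lebesgue_rV_aff// N0 mule0.
  + move=> x /= h; apply: fN => /= h'; apply: h => Ax.
    by rewrite fE; exact: h'.
- apply/cvgryPge => M.
  have [K _ KP] : \forall m \near \oo, M / a ^+ 2 <= lam m.
    by move/cvgryPge : lamoo; apply.
  exists K => // m /KP /=; rewrite ler_pdivrMr ?exprn_gt0//.
  by rewrite mulrC.
Qed.

End eigenbasis.

(** * Eigenvalues of dilations and of disjoint unions *)

Section eigenvalues.
Context {R : realType} {n : nat}.
Local Notation V := 'rV[R]_n.
Local Notation leb := (@lebesgue_rV R n).
Implicit Types (A B Omega : set V) (mu lambda a x : R) (b : V).

Lemma neumann_count_ge_le Omega N mu lambda : mu <= lambda ->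
  neumann_count_ge Omega N mu -> neumann_count_ge Omega N lambda.
Proof.
move=> ml [u [nu [eu iu]]]; exists u, nu; split => // j; have [euj nuj] := eu j.
by split => //; exact: le_trans ml.
Qed.

Section one_domain.
Variable Omega : set V.
Hypotheses (oO : open Omega) (dO : discrete_neumann_spectrum Omega).
Let mO : measurable Omega := open_measurable_rV oO.

Lemma neumann_count_ge0 mu : neumann_count_ge Omega 0 mu.
Proof.
have [w [lam bw]] := dO; apply/(neumann_count_geP _ _ mO bw).
by exists (fun=> 0%N); case.
Qed.

Lemma neumann_count_ge_leq N M mu : (N <= M)%N ->
  neumann_count_ge Omega M mu -> neumann_count_ge Omega N mu.
Proof.
have [w [lam bw]] := dO => NM /(neumann_count_geP _ _ mO bw)[f finj fmu].
apply/(neumann_count_geP _ _ mO bw); exists (f \o widen_ord NM).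
  by move=> i j /finj /(congr1 val) /= ij; exact: val_inj.
by move=> j; exact: fmu.
Qed.

Lemma neumann_count_ge_pos N mu : neumann_count_ge Omega N.+1 mu -> 0 <= mu.
Proof.
move=> [u [nu [eu _]]]; have [eu0 nu0] := eu ord0.
by apply: le_trans nu0; exact: neumann_eigenfunction_ge0 eu0.
Qed.

(** The defining infimum is over a set that is nonempty, since an eigenbasis
provides arbitrarily many eigenfunctions, and bounded below by [0]; it is thus
characterized by its lower bounds. *)
Lemma le_neumann_eigenvalueP k x : x <= neumann_eigenvalue Omega k <->
  forall lambda, neumann_count_ge Omega k.+1 lambda -> x <= lambda.
Proof.
split=> [xmu lambda c|xle].
  apply: le_trans xmu _; apply: ge_inf => //.
  by exists 0 => l; exact: neumann_count_ge_pos.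
apply: lb_le_inf => //; have [w [lam bw]] := dO.
exists (\big[Num.max/0]_(j < k.+1) lam j).
apply/(neumann_count_geP _ _ mO bw); exists (fun j => nat_of_ord j).
  by move=> i j; exact: val_inj.
by move=> j; apply: (le_bigmax _ (fun j : 'I_k.+1 => lam j)).
Qed.

Lemma neumann_eigenvalue_le k lambda : neumann_count_ge Omega k.+1 lambda ->
  neumann_eigenvalue Omega k <= lambda.
Proof. by have [+ _] := le_neumann_eigenvalueP k (neumann_eigenvalue Omega k); exact. Qed.

Lemma neumann_eigenvalue_ge0 k : 0 <= neumann_eigenvalue Omega k.
Proof. by apply/le_neumann_eigenvalueP => l; exact: neumann_count_ge_pos. Qed.

Lemma neumann_eigenvalue_homo k l : (k <= l)%N ->
  neumann_eigenvalue Omega k <= neumann_eigenvalue Omega l.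
Proof.
move=> kl; apply/le_neumann_eigenvalueP => lambda c.
by apply: neumann_eigenvalue_le; apply: neumann_count_ge_leq c.
Qed.

(** A negligible set carries no eigenfunction. *)
Lemma discrete_neumann_nonnegligible : ~ (\forall x \ae leb, ~ Omega x).
Proof.
have [w [lam [/(_ 0%N) [w0 _] _ _ _]]] := dO.
by apply: contra_not w0; apply: filterS => x.
Qed.

End one_domain.

Lemma discrete_neumann_aff a b A : 0 < a -> open A ->
  discrete_neumann_spectrum A -> discrete_neumann_spectrum (aff a b @^-1` A).
Proof.
by move=> a0 oA [w [lam bw]]; do 2 eexists; exact: (eigenbasis_aff b a0 oA bw).
Qed.

Lemma le_neumann_eigenvalue_aff a b A k x : 0 < a -> open A ->
  discrete_neumann_spectrum A -> x <= neumann_eigenvalue A k ->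
  a ^+ 2 * x <= neumann_eigenvalue (aff a b @^-1` A) k.
Proof.
move=> a0 oA dA xA; have oA' := @open_aff R n a b A oA.
have mA := open_measurable_rV oA; have mA' := open_measurable_rV oA'.
apply/(le_neumann_eigenvalueP oA' (discrete_neumann_aff b a0 oA dA)) => lambda.
have [w [lam bw]] := dA.
move=> /(neumann_count_geP _ _ mA' (eigenbasis_aff b a0 oA bw))[f finj fle].
rewrite mulrC -ler_pdivlMr ?exprn_gt0//.
move/(le_neumann_eigenvalueP oA dA) : xA; apply.
apply/(neumann_count_geP _ _ mA bw); exists f => // j.
by rewrite ler_pdivlMr ?exprn_gt0// mulrC.
Qed.

Section two_domains.
Variables A B : set V.
Hypotheses (oA : open A) (oB : open B) (AB0 : A `&` B = set0).
Hypotheses (dA : discrete_neumann_spectrum A) (dB : discrete_neumann_spectrum B).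
Let mA : measurable A := open_measurable_rV oA.
Let mB : measurable B := open_measurable_rV oB.
Let mAB : measurable (A `|` B). Proof. exact: measurableU. Qed.

Lemma discrete_neumannU : discrete_neumann_spectrum (A `|` B).
Proof.
have [[u [lam bu]] [v [mu bv]]] := (dA, dB).
by do 2 eexists; exact: (eigenbasisU oA oB AB0 bu bv).
Qed.
Let dAB := discrete_neumannU.
Let oAB : open (A `|` B). Proof. exact: openU. Qed.

Lemma neumann_count_geU p q lambda :
  neumann_count_ge A p lambda -> neumann_count_ge B q lambda ->
  neumann_count_ge (A `|` B) (p + q) lambda.
Proof.
have [[u [lam bu]] [v [mu bv]]] := (dA, dB).
move=> /(neumann_count_geP _ _ mA bu)[f finj fl].
move=> /(neumann_count_geP _ _ mB bv)[g ginj gl].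
apply/(neumann_count_geP _ _ mAB (eigenbasisU oA oB AB0 bu bv)).
exists (fun i : 'I_(p + q) => match fintype.split i with
  inl j => (f j).*2 | inr j => (g j).*2.+1 end).
  move=> i j; rewrite -[i]splitK -[j]splitK !unsplitK.
  case: (fintype.split i) => i'; case: (fintype.split j) => j'.
  - by move/double_inj/finj ->.
  - by move/(congr1 odd); rewrite /= !odd_double.
  - by move/(congr1 odd); rewrite /= !odd_double.
  - by move=> [] /double_inj/ginj ->.
move=> i; rewrite /interleave; case: (fintype.split i) => j.
  by rewrite odd_double doubleK.
by rewrite /= odd_double/= uphalf_double.
Qed.

(** The even and odd positions of the interleaved eigenbasis sort the counted
eigenvalues into those of [A] and those of [B]. *)
Lemma neumann_count_geU_split N lambda : neumann_count_ge (A `|` B) N lambda ->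
  exists p q, [/\ (p + q)%N = N, neumann_count_ge A p lambda &
    neumann_count_ge B q lambda].
Proof.
have [[u [lam bu]] [v [mu bv]]] := (dA, dB).
move=> /(neumann_count_geP _ _ mAB (eigenbasisU oA oB AB0 bu bv))[f finj fl].
pose P := [pred j : 'I_N | ~~ odd (f j)].
exists #|P|, #|predC P|; split; first by rewrite cardC card_ord.
  apply/(neumann_count_geP _ _ mA bu).
  exists (fun i : 'I_#|P| => (f (enum_val i))./2).
    move=> i j; have := enum_valP i; have := enum_valP j; rewrite !inE => oj oi.
    move=> e; apply/enum_val_inj/finj.
    by rewrite -[LHS]odd_double_half -[RHS]odd_double_half e (negbTE oi) (negbTE oj).
  move=> i; have := fl (enum_val i); have := enum_valP i; rewrite inE /interleave.
  by move=> /negbTE ->.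
apply/(neumann_count_geP _ _ mB bv).
exists (fun i : 'I_#|predC P| => (f (enum_val i))./2).
  move=> i j; have := enum_valP i; have := enum_valP j.
  rewrite !inE !negbK => oj oi e; apply/enum_val_inj/finj.
  by rewrite -[LHS]odd_double_half -[RHS]odd_double_half e oi oj.
move=> i; have := fl (enum_val i); have := enum_valP i.
by rewrite !inE negbK /interleave => ->.
Qed.

(** Pigeonhole: among [i + j + 1] eigenvalues of the union, at least [i + 1] come
from [A] or at least [j + 1] come from [B]. *)
Lemma le_neumann_eigenvalueU i j x : x <= neumann_eigenvalue A i ->
  x <= neumann_eigenvalue B j -> x <= neumann_eigenvalue (A `|` B) (i + j).
Proof.
move=> xA xB; apply/(le_neumann_eigenvalueP oAB dAB) => lambda.
move=> /neumann_count_geU_split[p [q [pq cA cB]]].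
have [ip|pi] := ltnP i p.
  move/(le_neumann_eigenvalueP oA dA) : xA; apply.
  exact: neumann_count_ge_leq cA.
move/(le_neumann_eigenvalueP oB dB) : xB; apply.
apply: neumann_count_ge_leq cB => //.
by rewrite -(ltn_add2l p) pq ltnS leq_add2r.
Qed.

(** Take for [i] the number of eigenvalues of [A] below [x]. Then the eigenvalue of
[A] of index [i] is at least [x], and since the union has at most [k] eigenvalues
below [x], the set [B] has at most [k - i]. The eigenvalue [0 < x] of the
constants belongs to both spectra, which keeps [i] strictly between [0] and [k]. *)
Lemma neumann_eigenvalueU_split k x : (0 < k)%N ->
  (leb A < +oo)%E -> (leb B < +oo)%E ->
  0 < x -> x <= neumann_eigenvalue (A `|` B) k ->
  exists i, [/\ (1 <= i <= k - 1)%N, x <= neumann_eigenvalue A i &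
    x <= neumann_eigenvalue B (k - i)].
Proof.
move=> k0 fA fB x0 xAB.
have c1 Omega : open Omega -> discrete_neumann_spectrum Omega ->
    (leb Omega < +oo)%E -> neumann_count_ge Omega 1 0.
  move=> oO dO fO; have mO := open_measurable_rV oO.
  have nO := discrete_neumann_nonnegligible dO.
  exists (fun=> cst 1), (fun=> 0); split.
    by split => //; exact: neumann_eigenfunction_cst.
  move=> c c0 j; apply: contrapT => cj0; apply: nO.
  apply: filterS c0 => y + Oy => /(_ Oy); rewrite big_ord1 mulr1.
  by rewrite (ord1 j) in cj0.
have excl p q lambda : neumann_count_ge A p lambda ->
    neumann_count_ge B q lambda -> lambda < x -> (p + q <= k)%N.
  move=> cA cB lx; rewrite leqNgt; apply/negP => pqk.
  have := neumann_count_geU cA cB => /(neumann_count_ge_leq oAB dAB pqk).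
  move/(le_neumann_eigenvalueP oAB dAB) : xAB => /[apply].
  by rewrite leNgt lx.
pose P p := `[< exists2 lambda, lambda < x & neumann_count_ge A p lambda >].
have P1 : P 1%N by apply/asboolP; exists 0 => //; exact: c1.
have Pk p : P p -> (p <= k)%N.
  move=> /asboolP[lambda lx cA]; rewrite -[p]addn0.
  by apply: excl cA (neumann_count_ge0 oB dB lambda) lx.
have exP : exists p, P p by exists 1%N.
case: (ex_maxnP exP Pk) => i /asboolP[l lx cA] imax.
have ik : (i <= k - 1)%N.
  have l0 : neumann_count_ge B 1 (Num.max l 0).
    apply: neumann_count_ge_le (c1 B oB dB fB).
    by rewrite le_max lexx orbT.
  have l1 : neumann_count_ge A i (Num.max l 0).
    by apply: neumann_count_ge_le cA; rewrite le_max lexx.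
  have := excl _ _ _ l1 l0; rewrite gt_max lx x0 => /(_ isT).
  by rewrite addn1 subn1 => ik; rewrite -ltnS prednK.
exists i; split; first by rewrite ik andbT; exact: imax.
  apply/(le_neumann_eigenvalueP oA dA) => lambda c; rewrite leNgt; apply/negP => xl.
  have : P i.+1 by apply/asboolP; exists lambda.
  by move=> /imax; rewrite ltnn.
apply/(le_neumann_eigenvalueP oB dB) => lambda c; rewrite leNgt; apply/negP => xl.
have cA' : neumann_count_ge A i (Num.max l lambda).
  by apply: neumann_count_ge_le cA; rewrite le_max lexx.
have cB' : neumann_count_ge B (k - i).+1 (Num.max l lambda).
  by apply: neumann_count_ge_le c; rewrite le_max lexx orbT.
have := excl _ _ _ cA' cB'; rewrite gt_max lx xl => /(_ isT).
by rewrite addnS subnKC ?ltnn// (leq_trans ik)// leq_subr.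
Qed.

End two_domains.

End eigenvalues.

(** * Geometry of domains *)

Section domains.
Context {R : realType} {n : nat}.
Local Notation V := 'rV[R]_n.
Local Notation leb := (@lebesgue_rV R n).
Implicit Types (A B Omega : set V) (a r : R) (b x y e : V).

Lemma dotrVDl x y e : dotrV (x + y) e = dotrV x e + dotrV y e.
Proof. by rewrite /dotrV mulmxDl mxE. Qed.

Lemma dotrVZl a x e : dotrV (a *: x) e = a * dotrV x e.
Proof. by rewrite /dotrV -scalemxAl mxE. Qed.

(** The direction [e] is kept and the graph is dilated; [pb] is the projection of
the translation vector [b] on the hyperplane orthogonal to [e]. The Lipschitz
constant does not change. *)
Lemma lipschitz_boundary_aff a b A : 0 < a -> open A ->
  lipschitz_boundary A -> lipschitz_boundary (aff a b @^-1` A).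
Proof.
move=> a0 oA lA x [clx nx].
have nAx : ~ A (aff a b x).
  apply: contra_not nx => Ax.
  apply: (open_nbhs_nbhs (conj (@open_aff R n a b A oA) Ax)).
have : (closure A `\` A°) (aff a b x).
  split; last by move=> /interior_subset.
  move=> S nS; have [y [Ay Sy]] := clx _ (@continuous_aff R n a b x S nS).
  by exists (aff a b y).
move=> /lA[e [gamma [r [e1 lg r0 Ar]]]].
pose pb := b - dotrV b e *: e.
exists e, (fun z => (gamma (aff a pb z) - dotrV b e) / a), (r / a); split => //.
- move: lg => [M0 [M0r lM0]]; exists M0; split => // M /lM0 lM [y z] _ /=.
  rewrite -mulrBl opprB addrA addrNK normrM normfV (gtr0_norm a0).
  rewrite ler_pdivrMr// -mulrA.
  have := lM (aff a pb y, aff a pb z) (conj Logic.I Logic.I) => /=.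
  move/le_trans; apply; rewrite /aff opprD addrACA subrr addr0 -scalerBr.
  by rewrite normrZ (gtr0_norm a0) (mulrC a).
- by rewrite divr_gt0.
move=> y xy; have : ball (aff a b x) r (aff a b y).
  move: xy; rewrite -!ball_normE/= /aff opprD addrACA subrr addr0 -scalerBr.
  by rewrite normrZ (gtr0_norm a0) ltr_pdivlMr// mulrC.
move=> /Ar; rewrite /preimage/= => ->.
have -> : aff a b y - dotrV (aff a b y) e *: e = aff a pb (y - dotrV y e *: e).
  rewrite /aff /pb dotrVDl dotrVZl scalerBr scalerDl opprD addrACA scalerA.
  by [].
by rewrite /aff dotrVDl dotrVZl ltr_pdivrMr// ltrBlDr mulrC.
Qed.

Let lipschitz_boundaryU_half A B x : lipschitz_boundary A ->
  closure A x -> ~ A x -> open A -> ~ closure B x ->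
  exists (e : V) (gamma : V -> R) (r : R),
      [/\ dotrV e e = 1, lipschitz gamma, 0 < r
        & forall y, ball x r y ->
            ((A `|` B) y <-> gamma (y - dotrV y e *: e) < dotrV y e)].
Proof.
move=> lA clA nAx oA nclB.
have [e [gamma [r [e1 lg r0 Ar]]]] : exists (e : V) (gamma : V -> R) (r : R),
      [/\ dotrV e e = 1, lipschitz gamma, 0 < r
        & forall y, ball x r y ->
            (A y <-> gamma (y - dotrV y e *: e) < dotrV y e)].
  by apply: lA; split => // /interior_subset.
have /nbhs_ballP[s /= s0 xsB] : nbhs x (~` closure B).
  by apply: open_nbhs_nbhs; split => //; exact/closed_openC/closed_closure.
exists e, gamma, (Num.min r s); split => //; first by rewrite lt_min r0 s0.
move=> y xy; have xry : ball x r y by apply: le_ball xy; rewrite ge_min lexx.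
have xsy : ball x s y by apply: le_ball xy; rewrite ge_min lexx orbT.
rewrite -Ar//; split; [case=> // By|by left].
by have := xsB _ xsy; case; exact: subset_closure.
Qed.

(** With disjoint closures, a boundary point of the union is a boundary point of one
piece and has a neighbourhood that misses the other one. *)
Lemma lipschitz_boundaryU A B : open A -> open B ->
  closure A `&` closure B = set0 ->
  lipschitz_boundary A -> lipschitz_boundary B -> lipschitz_boundary (A `|` B).
Proof.
move=> oA oB AB0 lA lB x [clAB nAB].
have [nAx nBx] : ~ A x /\ ~ B x.
  split; apply: contra_not nAB => h; apply: open_nbhs_nbhs (conj (openU oA oB) _);
  by [left|right].
have disj : closure A x -> closure B x -> False.
  by move=> cA cB; have : (closure A `&` closure B) x by []; rewrite AB0.
have [clA|nclA] := pselect (closure A x).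
  by apply: lipschitz_boundaryU_half => // clB; exact: disj.
have clB : closure B x by move: clAB; rewrite closureU => -[].
rewrite setUC; exact: lipschitz_boundaryU_half.
Qed.

Lemma is_domain_aff a b A : 0 < a -> is_domain A ->
  is_domain (aff a b @^-1` A).
Proof.
move=> a0 [[x0 Ax0] [M [Mr AM]] oA lA dA]; split.
- by exists (aff a^-1 (- (a^-1 *: b)) x0); rewrite /preimage/= affVK.
- exists (a^-1 * (M + 1 + `|b|)); split; first exact: num_real.
  move=> N /ltW MN x Ax; apply: le_trans MN; rewrite ler_pdivlMl//.
  have := AM (M + 1) _ _ Ax; rewrite ltrDl => /(_ ltr01) axM.
  rewrite -{1}(gtr0_norm a0) -normrZ -[a *: x](addrK b).
  by rewrite (le_trans (ler_normB _ _))// lerD2r.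
- exact: open_aff.
- exact: lipschitz_boundary_aff.
- exact: discrete_neumann_aff.
Qed.

Lemma is_domainU A B : closure A `&` closure B = set0 ->
  is_domain A -> is_domain B -> is_domain (A `|` B).
Proof.
move=> AB0 [[x0 Ax0] bA oA lA dA] [_ bB oB lB dB].
have dAB : A `&` B = set0.
  by rewrite -subset0 => x [Ax Bx]; rewrite -AB0; split; exact: subset_closure.
split.
- by exists x0; left.
- move: bA bB => [M [Mr AM]] [N [Nr BN]]; exists (Num.max M N); split.
    exact: num_real.
  by move=> r; rewrite gt_max => /andP[Mr' Nr'] x [Ax|Bx]; [exact: AM Ax|exact: BN Bx].
- exact: openU.
- exact: lipschitz_boundaryU.
- exact: discrete_neumannU.
Qed.

Let closure_bounded A b r : (forall x, A x -> `|x + b| <= r) ->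
  forall x, closure A x -> `|x + b| <= r.
Proof.
move=> Ar x clx; rewrite leNgt; apply/negP => rx.
have /clx[y [/Ar yr]] : nbhs x (ball x (`|x + b| - r)).
  by apply: nbhsx_ballx; rewrite subr_gt0.
rewrite -ball_normE/= ltNge => /negP; apply.
have -> : x - y = (x + b) - (y + b) by rewrite opprD addrACA subrr addr0.
by rewrite (le_trans _ (lerB_dist _ _))// lerB.
Qed.

(** If both sets have norm at most [r], a translation by a vector of norm larger
than [2 r] suffices. *)
Lemma separate_translate A B : (0 < n)%N -> bounded_set A -> bounded_set B ->
  exists b, closure A `&` closure (aff 1 b @^-1` B) = set0.
Proof.
move=> n0 [M [_ AM]] [N [_ BN]].
pose r := `|M| + `|N| + 1.
have Ar x : A x -> `|x + 0| <= r.
  rewrite addr0; apply: AM; rewrite (le_lt_trans (ler_norm M))//.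
  by rewrite /r -addrA ltrDl ltr_wpDl.
have Br x : B x -> `|x| <= r.
  apply: BN; rewrite (le_lt_trans (ler_norm N))//.
  by rewrite /r addrAC addrC ltrDl ltr_wpDl.
have r0 : 0 < r by rewrite /r ltr_wpDl// addr_ge0.
pose i0 : 'I_n := Ordinal n0.
pose b : V := (r + r + 1) *: delta_mx ord0 i0.
have Br' x : (aff 1 b @^-1` B) x -> `|x + b| <= r.
  by move=> /Br; rewrite /aff scale1r.
exists b; rewrite -subset0 => x [/(closure_bounded Ar) + /(closure_bounded Br')].
rewrite addr0 => xr xbr.
have : `|b| <= r + r.
  by rewrite -(addrK x b) (le_trans (ler_normB _ _))// lerD// addrC.
apply/negP; rewrite -ltNge; apply: lt_le_trans (norm_coord_le b i0).
have -> : b ord0 i0 = r + r + 1 by rewrite /b !mxE !eqxx mulr1.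
by rewrite gtr0_norm ?ltrDl//; exact: addr_gt0 (addr_gt0 r0 r0) ltr01.
Qed.

Lemma volume_aff a b A : 0 < a -> is_domain A ->
  volume (aff a b @^-1` A) = ((a ^- n)%:E * volume A)%E.
Proof.
by move=> a0 [_ _ oA _ _]; exact: (lebesgue_rV_aff b a0 (open_measurable_rV oA)).
Qed.

Lemma volumeU A B : is_domain A -> is_domain B -> A `&` B = set0 ->
  volume (A `|` B) = (volume A + volume B)%E.
Proof.
move=> [_ _ oA _ _] [_ _ oB _ _] AB0.
by rewrite /volume measureU//; exact: open_measurable_rV.
Qed.

Lemma volume_fin_num A : is_domain A -> volume A \is a fin_num.
Proof.
move=> [_ bA oA _ _]; rewrite ge0_fin_numE ?measure_ge0//.
by apply: bounded_lebesgue_rV => //; exact: open_measurable_rV.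
Qed.

(** A null set would have no eigenfunction, while the spectrum is not empty. *)
Lemma volume_gt0 A : is_domain A -> (0 < volume A)%E.
Proof.
move=> [_ _ oA _ dA]; rewrite lt0e measure_ge0 andbT; apply/eqP => vA0.
apply: (discrete_neumann_nonnegligible dA); exists A; split => //.
  exact: open_measurable_rV.
by move=> x /= /contrapT.
Qed.

End domains.

(** * Domains of volume one and optimal eigenvalues *)

Section rescaling.
Context {R : realType} {n : nat}.
Hypothesis n0 : (0 < n)%N.
Local Notation V := 'rV[R]_n.
Implicit Types (A B C D : set V) (a x y : R) (b : V).
Local Notation p := (n%:R / 2 : R).

Definition unit_domain C := is_domain C /\ volume C = 1%E.

Let p0 : 0 < p. Proof. by rewrite divr_gt0// ltr0n. Qed.

Lemma powR_sqrM a x : 0 < a -> 0 <= x -> (a ^+ 2 * x) `^ p = a ^+ n * x `^ p.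
Proof.
move=> a0 x0; rewrite powRM ?sqr_ge0//; congr (_ * _).
by rewrite -powR_mulrn ?ltW// -powRrM mulrC divfK// powR_mulrn// ltW.
Qed.

Lemma le_powR_half x y : 0 <= x -> x <= y -> x `^ p <= y `^ p.
Proof.
move=> x0 xy; have y0 := le_trans x0 xy; have pge0 := ltW p0.
by apply: ge0_ler_powR.
Qed.

Lemma powR_halfK x : 0 <= x -> (x `^ p^-1) `^ p = x.
Proof. by move=> x0; rewrite -powRrM mulVf ?gt_eqF// powRr1. Qed.

Lemma domain_neumann_eigenvalue_ge0 A k : is_domain A ->
  0 <= neumann_eigenvalue A k.
Proof. by move=> [_ _ oA _ dA]; exact: neumann_eigenvalue_ge0. Qed.

(** The quantity [mu_k ^ (n/2) * volume] is invariant under dilations; dilating by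
[v ^ (-1/n)] brings the volume to [1]. *)
Lemma unit_rescaling A k : is_domain A ->
  exists2 C, unit_domain C &
    neumann_eigenvalue A k `^ p * fine (volume A) <= neumann_eigenvalue C k `^ p.
Proof.
move=> domA; have [_ _ oA _ dA] := domA.
have vAf := volume_fin_num domA; have vA0 := volume_gt0 domA.
set v := fine _; have v0 : 0 < v by rewrite fine_gt0// vA0 ltey_eq vAf.
pose a := v `^ n%:R^-1; have a0 : 0 < a by rewrite powR_gt0.
have an : a ^+ n = v.
  by rewrite -powR_mulrn ?ltW// -powRrM mulVf ?powRr1 ?ltW// pnatr_eq0 -lt0n.
exists (aff a 0 @^-1` A).
  split; first exact: is_domain_aff.
  by rewrite volume_aff// an -(fineK vAf) -EFinM mulVf// gt_eqF.
rewrite mulrC -an -powR_sqrM//; last exact: domain_neumann_eigenvalue_ge0.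
apply: le_powR_half.
  by rewrite mulr_ge0 ?sqr_ge0//; exact: domain_neumann_eigenvalue_ge0.
exact: le_neumann_eigenvalue_aff.
Qed.

(** The construction of Wolf and Keller. Dilate [C] and [D] so that the eigenvalues
of index [i] and [j] take the same value [l], and place the copies apart. The
union then has eigenvalue of index [i + j] at least [l], and its volume is
[(x ^ (n/2) + y ^ (n/2)) / l ^ (n/2)], so [l ^ (n/2) = x ^ (n/2) + y ^ (n/2)]
normalizes it. If one of [x], [y] vanishes, the other domain alone does, since
the eigenvalues increase with the index. *)
Lemma unit_domain_union C D i j : unit_domain C -> unit_domain D ->
  exists2 E, unit_domain E &
    neumann_eigenvalue C i `^ p + neumann_eigenvalue D j `^ p <=
    neumann_eigenvalue E (i + j) `^ p.
Proof.
move=> uC uD; have [[domC vC] [domD vD]] := (uC, uD).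
have [_ bC oC _ dC] := domC; have [_ bD oD _ dD] := domD.
have x0 := domain_neumann_eigenvalue_ge0 i domC.
have y0 := domain_neumann_eigenvalue_ge0 j domD.
set x := neumann_eigenvalue C i in x0 *; set y := neumann_eigenvalue D j in y0 *.
have [x00|xn0] := eqVneq x 0.
  exists D => //; rewrite x00 powR0 ?gt_eqF// add0r le_powR_half//.
  by apply: neumann_eigenvalue_homo => //; rewrite leq_addl.
have [y00|yn0] := eqVneq y 0.
  exists C => //; rewrite y00 powR0 ?gt_eqF// addr0 le_powR_half//.
  by apply: neumann_eigenvalue_homo => //; rewrite leq_addr.
have {}x0 : 0 < x by rewrite lt0r xn0.
have {}y0 : 0 < y by rewrite lt0r yn0.
pose s := x `^ p + y `^ p.
have s0 : 0 < s by rewrite addr_gt0// powR_gt0.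
pose l := s `^ p^-1; have l0 : 0 < l by rewrite powR_gt0.
have lp : l `^ p = s by rewrite powR_halfK// ltW.
have scale z : 0 < z -> Num.sqrt (l / z) ^+ 2 * z = l.
  by move=> z0; rewrite sqr_sqrtr ?divr_ge0 ?ltW// divfK// gt_eqF.
have scale_gt0 z : 0 < z -> 0 < Num.sqrt (l / z).
  by move=> z0; rewrite sqrtr_gt0 divr_gt0.
have scale_vol z : 0 < z -> Num.sqrt (l / z) ^- n = z `^ p / s.
  move=> z0; have := powR_sqrM (scale_gt0 z z0) (ltW z0).
  rewrite scale// lp => ->; rewrite invfM mulrCA mulfV ?mulr1//.
  by rewrite gt_eqF// powR_gt0.
pose C' := aff (Num.sqrt (l / x)) 0 @^-1` C.
pose D0 := aff (Num.sqrt (l / y)) 0 @^-1` D.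
have domC' : is_domain C' by apply: is_domain_aff => //; exact: scale_gt0.
have domD0 : is_domain D0 by apply: is_domain_aff => //; exact: scale_gt0.
have [_ bC' oC' _ dC'] := domC'; have [_ bD0 oD0 _ dD0] := domD0.
have [b CD0] := separate_translate n0 bC' bD0.
pose D' := aff 1 b @^-1` D0.
have domD' : is_domain D' by exact: is_domain_aff.
have [_ bD' oD' _ dD'] := domD'.
have C'D' : C' `&` D' = set0.
  by rewrite -subset0 => z [Cz Dz]; rewrite -CD0; split; exact: subset_closure.
exists (C' `|` D').
  split; first exact: is_domainU.
  rewrite volumeU// volume_aff ?scale_gt0// [volume D']volume_aff//.
  rewrite volume_aff ?scale_gt0// vC vD !mule1 !scale_vol// expr1n invr1 mul1e.
  by rewrite -EFinD -mulrDl mulfV// gt_eqF.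
rewrite -[leLHS]lp; apply: le_powR_half; first exact: ltW.
apply: le_neumann_eigenvalueU => //.
  by rewrite -{1}(scale x x0); apply: le_neumann_eigenvalue_aff => //; exact: scale_gt0.
rewrite -[leLHS]mul1r -[X in X * _](expr1n _ 2).
apply: le_neumann_eigenvalue_aff => //.
by rewrite -{1}(scale y y0); apply: le_neumann_eigenvalue_aff => //; exact: scale_gt0.
Qed.

End rescaling.

Section optimal_eigenvalues.
Context {R : realType} {n : nat}.
Hypothesis n0 : (0 < n)%N.
Local Notation V := 'rV[R]_n.
Implicit Types (A B C D : set V).
Local Notation p := (n%:R / 2 : R).
Local Notation mustar := (neumann_eigenvalue_sup R n).
Let p0 : 0 < p. Proof. by rewrite divr_gt0// ltr0n. Qed.

Lemma le_neumann_eigenvalue_sup C k : unit_domain C ->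
  ((neumann_eigenvalue C k)%:E <= mustar k)%E.
Proof. by move=> uC; apply: ereal_sup_ubound; exists C. Qed.

Lemma neumann_eigenvalue_sup_homo k l : (k <= l)%N -> (mustar k <= mustar l)%E.
Proof.
move=> kl; apply: ub_ereal_sup => _ [C uC <-].
apply: le_trans (le_neumann_eigenvalue_sup l uC).
have [[_ _ oC _ dC] _] := uC.
by rewrite lee_fin; exact: neumann_eigenvalue_homo.
Qed.

(** From here on the supremum of index [k] is finite, and so are those of smaller
index. The domain [C0] shows that the suprema are taken over a nonempty set. *)
Variables (C0 : set V) (k : nat).
Hypotheses (uC0 : unit_domain C0) (supk : (mustar k < +oo)%E).

Lemma neumann_eigenvalue_sup_fin_num i : (i <= k)%N -> mustar i \is a fin_num.
Proof.
move=> ik; rewrite ge0_fin_numE.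
  by apply: le_lt_trans supk; exact: neumann_eigenvalue_sup_homo.
apply: le_trans (le_neumann_eigenvalue_sup i uC0).
by rewrite lee_fin domain_neumann_eigenvalue_ge0//; case: uC0.
Qed.

Let fine_le C i : (i <= k)%N -> unit_domain C ->
  neumann_eigenvalue C i <= fine (mustar i).
Proof.
move=> ik uC; rewrite -lee_fin fineK ?neumann_eigenvalue_sup_fin_num//.
exact: le_neumann_eigenvalue_sup.
Qed.

Let powR_fine_le C i : (i <= k)%N -> unit_domain C ->
  neumann_eigenvalue C i `^ p <= fine (mustar i) `^ p.
Proof.
move=> ik uC; apply: (le_powR_half n0); last exact: fine_le.
by apply: domain_neumann_eigenvalue_ge0; case: uC.
Qed.

(** Upper bounds of the powers [mu ^ (n/2)] are turned into upper bounds of the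
eigenvalues by the inverse power, and from there of their supremum. *)
Let powR_fine_lub i q : (i <= k)%N ->
  (forall C, unit_domain C -> neumann_eigenvalue C i `^ p <= q) ->
  fine (mustar i) `^ p <= q.
Proof.
move=> ik qP; have q0 : 0 <= q by apply: le_trans (qP _ uC0); exact: powR_ge0.
rewrite -[leRHS](powR_halfK n0 q0); apply: (le_powR_half n0).
  apply: le_trans (fine_le ik uC0).
  by apply: domain_neumann_eigenvalue_ge0; case: uC0.
rewrite -lee_fin fineK ?neumann_eigenvalue_sup_fin_num//.
apply: ub_ereal_sup => _ [C uC <-]; rewrite lee_fin.
have mu0 : 0 <= neumann_eigenvalue C i.
  by apply: domain_neumann_eigenvalue_ge0; case: uC.
have -> : neumann_eigenvalue C i = (neumann_eigenvalue C i `^ p) `^ p^-1.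
  by rewrite -powRrM mulfV ?gt_eqF// powRr1.
have pVge0 : 0 <= p^-1 by rewrite invr_ge0 ltW.
by apply: ge0_ler_powR; rewrite ?nnegrE ?powR_ge0//; exact: qP.
Qed.

(** Take the supremum over [C] and [D], one after the other, in [unit_domain_union]. *)
Lemma neumann_eigenvalue_sup_superadditive i j : (i + j)%N = k ->
  fine (mustar i) `^ p + fine (mustar j) `^ p <= fine (mustar k) `^ p.
Proof.
move=> ijk; have ik : (i <= k)%N by rewrite -ijk leq_addr.
have jk : (j <= k)%N by rewrite -ijk leq_addl.
rewrite -lerBrDr; apply: powR_fine_lub => // C uC.
rewrite lerBrDr -lerBrDl; apply: powR_fine_lub => // D uD.
rewrite lerBrDl; have [E uE] := unit_domain_union n0 i j uC uD.
move/le_trans; apply; rewrite ijk; exact: powR_fine_le.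
Qed.

Lemma neumann_eigenvalue_volume_le A i : (i <= k)%N -> is_domain A ->
  neumann_eigenvalue A i `^ p * fine (volume A) <= fine (mustar i) `^ p.
Proof.
move=> ik domA; have [C uC] := unit_rescaling n0 i domA.
by move/le_trans; apply; exact: powR_fine_le.
Qed.

End optimal_eigenvalues.

(** * Near-optimal disjoint unions *)

(** In a chain [s - eps <= t <= a + b <= a' + b' <= s] of total slack [eps], each
link, and each summand of a link, loses at most [eps]. *)
Lemma sandwich_defects (R : realDomainType) (s t a b a' b' eps : R) :
  s - eps <= t -> t <= a + b -> a <= a' -> b <= b' -> a' + b' <= s ->
  [/\ 0 <= s - (a' + b') <= eps, 0 <= a' - a <= eps & 0 <= b' - b <= eps].
Proof. by move=> *; split; apply/andP; split; lra. Qed.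

Local Open Scope ereal_scope.

Theorem theorem2p3 (R : realType) (n k : nat) (eps : R)
    (hn : (2 <= n)%N) (hk : (2 <= k)%N) (heps : (0 <= eps)%R)
    (A B : set 'rV[R]_n)
    (dA : is_domain A) (dB : is_domain B) (dAB : is_domain (A `|` B))
    (AB0 : A `&` B = set0) (volAB : volume A + volume B = 1)
    (hAB : neumann_eigenvalue_sup R n k `^ (n%:R / 2) - eps%:E <=
           (neumann_eigenvalue (A `|` B) k)%:E `^ (n%:R / 2)) :
  exists i : nat,
    [/\ (1 <= i <= k - 1)%N,
        0 <= neumann_eigenvalue_sup R n k `^ (n%:R / 2) -
             (neumann_eigenvalue_sup R n i `^ (n%:R / 2) +
              neumann_eigenvalue_sup R n (k - i) `^ (n%:R / 2)) <= eps%:E,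
        0 <= neumann_eigenvalue_sup R n i `^ (n%:R / 2) -
             (neumann_eigenvalue A i)%:E `^ (n%:R / 2) * volume A <= eps%:E
      & 0 <= neumann_eigenvalue_sup R n (k - i) `^ (n%:R / 2) -
             (neumann_eigenvalue B (k - i))%:E `^ (n%:R / 2) * volume B
          <= eps%:E].
Proof.
have n0 : (0 < n)%N by exact: ltnW.
have p0 : (0 < n%:R / 2 :> R)%R by rewrite divr_gt0// ltr0n.
have uAB : unit_domain (A `|` B) by split; rewrite ?volumeU.
(* An infinite supremum would contradict [hAB], whose right-hand side is
   finite. *)
have supk : neumann_eigenvalue_sup R n k < +oo.
  rewrite ltey; apply/eqP => supE; move: hAB.
  by rewrite supE poweRyr ?gt_eqF// poweR_EFin addye// leye_eq.
have [vAf vBf] := (volume_fin_num dA, volume_fin_num dB).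
have [[_ _ oA _ sA] [_ _ oB _ sB]] := (dA, dB).
pose mu := neumann_eigenvalue (A `|` B) k.
have mu0 : (0 <= mu)%R by exact: domain_neumann_eigenvalue_ge0.
have [vA0 vB0] := (fine_ge0 (ltW (volume_gt0 dA)), fine_ge0 (ltW (volume_gt0 dB))).
have v1 : (fine (volume A) + fine (volume B) = 1)%R.
  by rewrite -fineD// volAB.
have [i [ik muA muB]] : exists i, [/\ (1 <= i <= k - 1)%N,
    (mu <= neumann_eigenvalue A i)%R & (mu <= neumann_eigenvalue B (k - i))%R].
  have [mu_gt0|mu_le0] := ltP 0%R mu.
    apply: neumann_eigenvalueU_split => //; first exact: ltnW.
      by rewrite ltey_eq vAf.
    by rewrite ltey_eq vBf.
  (* For [mu = 0] any index does, as eigenvalues are nonnegative. *)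
  exists 1%N; split; first by rewrite leqnn subn1 -ltnS prednK// ltnW.
    exact: le_trans mu_le0 (domain_neumann_eigenvalue_ge0 _ dA).
  exact: le_trans mu_le0 (domain_neumann_eigenvalue_ge0 _ dB).
have ik' : (i <= k)%N by case/andP : ik => _ /leq_trans; apply; exact: leq_subr.
have kik : (k - i <= k)%N by exact: leq_subr.
have super := neumann_eigenvalue_sup_superadditive n0 uAB supk (subnKC ik').
have A_le := neumann_eigenvalue_volume_le n0 uAB supk ik' dA.
have B_le := neumann_eigenvalue_volume_le n0 uAB supk kik dB.
have supf j : (j <= k)%N -> neumann_eigenvalue_sup R n j \is a fin_num.
  by move=> jk; exact: (neumann_eigenvalue_sup_fin_num uAB supk jk).
have muA_le := ler_wpM2r vA0 (le_powR_half n0 mu0 muA).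
have muB_le := ler_wpM2r vB0 (le_powR_half n0 mu0 muB).
move: hAB; rewrite -/mu -(fineK (supf k _))// !poweR_EFin -EFinB lee_fin => hAB'.
exists i; rewrite -(fineK (supf i ik')) -(fineK (supf _ kik)).
rewrite -(fineK vAf) -(fineK vBf) !poweR_EFin.
have mu_split : (mu `^ (n%:R / 2) * fine (volume A) +
    mu `^ (n%:R / 2) * fine (volume B) = mu `^ (n%:R / 2))%R.
  by rewrite -mulrDr v1 mulr1.
have mu_le := lerD muA_le muB_le; rewrite mu_split in mu_le.
have [? ? ?] := sandwich_defects hAB' mu_le A_le B_le super.
by split.
Qed.
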